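(* Let $X$ and $Y$ be disjoint finite alphabets and let $u\in\overline{X}^*$ and $v\in\overline{Y}^*$ be non-empty reduced words. Then the prefix membership problem is decidable for the group defined by the (cyclically pinched) presentation $$\mathrm{Gp}\langle X\cup Y\,|\,uv^{-1}=1\rangle.$$ Consequently, the word problem is decidable for the one-relator inverse monoid $$\mathrm{Inv}\langle X\cup Y\,|\,uv^{-1}=1\rangle.$$
   Context: For an alphabet $Z$, $\overline{Z}=Z\cup Z^{-1}$. $\mathrm{Gp}\langle Z\,|\,w=1\rangle$ and $\mathrm{Inv}\langle Z\,|\,w=1\rangle$ are the group, respectively the inverse monoid, presented by generators $Z$ and relation $w=1$ (the latter is the quotient of the free inverse monoid on $Z$ by the congruence generated by $(w,1)$). The prefix monoid $P_w$ is the submonoid of $G=\mathrm{Gp}\langle Z\,|\,w=1\rangle$ generated by the elements represented by all prefixes of $w$. The prefix membership problem for $\mathrm{Gp}\langle Z\,|\,w=1\rangle$ is decidable if there is an algorithm which, given $p\in\overline{Z}^*$, decides whether the element of $G$ represented by $p$ lies in $P_w$. The word problem of the inverse monoid is to decide, given two words over $\overline{Z}$, whether they represent the same element. *)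

(* Defs.v *)
From mathcomp Require Import all_boot.

Set Implicit Arguments.
Unset Strict Implicit.
Unset Printing Implicit Defensive.

(** * Computability *)

(** Kleene's general recursive functions: the total functions on tuples of
    naturals obtained from the basic ones by composition, primitive recursion
    and minimization of regular functions (those for which the sought zero
    always exists).  By the normal form theorem these are exactly the total
    Turing-computable functions.  Decidability cannot be expressed as
    [exists f : word -> bool, ...], which holds of every predicate under
    classical logic and choice. *)
Inductive recursive : forall n, (n.-tuple nat -> nat) -> Prop :=
| rec_zero n : recursive (fun _ : n.-tuple nat => 0)
| rec_succ : recursive (fun t : 1.-tuple nat => (thead t).+1)
| rec_proj n (i : 'I_n) : recursive (fun t : n.-tuple nat => tnth t i)
| rec_comp m n (f : m.-tuple nat -> nat) (g : 'I_m -> n.-tuple nat -> nat) :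
    recursive f -> (forall i, recursive (g i)) ->
    recursive (fun t : n.-tuple nat => f [tuple g i t | i < m])
| rec_prim n (f : n.-tuple nat -> nat) (g : n.+2.-tuple nat -> nat) :
    recursive f -> recursive g ->
    recursive (fun t : n.+1.-tuple nat =>
      let s : n.-tuple nat := [tuple of behead t] in
      iteri (thead t) (fun i r => g [tuple of i :: r :: s]) (f s))
| rec_mu n (f : n.+1.-tuple nat -> nat)
    (f_reg : forall t : n.-tuple nat, exists k, f [tuple of k :: t] == 0) :
    recursive f -> recursive (fun t : n.-tuple nat => ex_minn (f_reg t))
| rec_ext n (f g : n.-tuple nat -> nat) :
    f =1 g -> recursive f -> recursive g.

(** [CodeSeq.code] is the effective bijection
    [n_1, ..., n_k |-> 2^n_1 (1 + 2 (2^n_2 (1 + 2 ...)))] from sequences of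
    naturals to naturals. *)
Definition code_seq (A : finType) (s : seq A) : nat :=
  CodeSeq.code [seq nat_of_ord (enum_rank a) | a <- s].

Definition decidable_set (A : finType) (P : seq A -> Prop) : Prop :=
  exists chi : 1.-tuple nat -> nat,
    recursive chi /\
    forall p, (P p /\ chi [tuple code_seq p] = 1) \/
              (~ P p /\ chi [tuple code_seq p] = 0).

Definition decidable_rel (A : finType) (E : seq A -> seq A -> Prop) : Prop :=
  exists chi : 2.-tuple nat -> nat,
    recursive chi /\
    forall p q, (E p q /\ chi [tuple code_seq p; code_seq q] = 1) \/
                (~ E p q /\ chi [tuple code_seq p; code_seq q] = 0).

(** * Words over an alphabet and its formal inverses *)

(** [(z, false)] is the generator [z] and [(z, true)] its formal inverse. *)
Definition letter (Z : Type) : Type := (Z * bool)%type.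
Definition word (Z : Type) : Type := seq (letter Z).

Definition linv (Z : Type) (a : letter Z) : letter Z := (a.1, ~~ a.2).

Definition winv (Z : Type) (p : word Z) : word Z := rev (map (@linv Z) p).

Definition wmap (Z Z' : Type) (f : Z -> Z') (p : word Z) : word Z' :=
  [seq (f a.1, a.2) | a <- p].

Definition reduced (Z : eqType) (p : word Z) : bool :=
  sorted (fun a b : Z * bool => b != linv a) p.

(** * Presentations *)

(** Elements of a presented group or monoid are words up to the congruence
    generated by the defining relations. *)
Inductive congruence_gen (A : Type) (R : seq A -> seq A -> Prop) :
  seq A -> seq A -> Prop :=
| cg_rel p q : R p q -> congruence_gen R p q
| cg_refl p : congruence_gen R p p
| cg_sym p q : congruence_gen R p q -> congruence_gen R q p
| cg_trans p q r :
    congruence_gen R p q -> congruence_gen R q r -> congruence_gen R p r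
| cg_cat p p' q q' :
    congruence_gen R p p' -> congruence_gen R q q' ->
    congruence_gen R (p ++ q) (p' ++ q').

Inductive gp_rel (Z : Type) (w : word Z) : word Z -> word Z -> Prop :=
| gp_free a : gp_rel w [:: a; linv a] [::]
| gp_relator : gp_rel w w [::].

Definition gp_eq (Z : Type) (w : word Z) : word Z -> word Z -> Prop :=
  congruence_gen (gp_rel w).

(** The first two families (the Vagner relations) present the free inverse
    monoid. *)
Inductive inv_rel (Z : Type) (w : word Z) : word Z -> word Z -> Prop :=
| inv_regular p : inv_rel w (p ++ winv p ++ p) p
| inv_idempotents p q :
    inv_rel w (p ++ winv p ++ q ++ winv q) (q ++ winv q ++ p ++ winv p)
| inv_relator : inv_rel w w [::].

Definition inv_eq (Z : Type) (w : word Z) : word Z -> word Z -> Prop :=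
  congruence_gen (inv_rel w).

(** [prefix_monoid w p]: the element of Gp<Z | w = 1> represented by [p] lies
    in the submonoid generated by the prefixes of [w]. *)
Inductive prefix_monoid (Z : eqType) (w : word Z) : word Z -> Prop :=
| pm_prefix p : prefix (p : seq (Z * bool)) w -> prefix_monoid w p
| pm_one : prefix_monoid w [::]
| pm_mul p q :
    prefix_monoid w p -> prefix_monoid w q -> prefix_monoid w (p ++ q)
| pm_eq p q : gp_eq w p q -> prefix_monoid w p -> prefix_monoid w q.

Definition prefix_membership_decidable (Z : finType) (w : word Z) : Prop :=
  @decidable_set (Z * bool)%type (prefix_monoid w).

Definition inv_word_problem_decidable (Z : finType) (w : word Z) : Prop :=
  @decidable_rel (Z * bool)%type (inv_eq w).

(** The relator [u v^-1] over the disjoint union of the two alphabets. *)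
Definition pinched (X Y : Type) (u : word X) (v : word Y) : word (X + Y) :=
  wmap inl u ++ winv (wmap inr v).

(* Main.v *)
Require Import Defs.
From mathcomp Require Import all_boot.
From Stdlib Require Import Setoid Morphisms Operators_Properties Relation_Operators.
From mathcomp Require Import ssralg ssrint zify.
From mathcomp.classical Require Import boolp.
(* Gives [inv_eq] back its meaning, hidden by [eqtype.inv_eq]. *)
Import Defs.

Set Implicit Arguments.
Unset Strict Implicit.
Unset Printing Implicit Defensive.

(** Write [c] for [u] or [v].  Since [u = v] in the group [G], the prefix monoid [P] is
    generated by the prefixes of [u] and of [v].  Add the inverse of [c] to the prefixes
    when one of the two sides generates it: the submonoids [M_X], [M_Y] of the free
    factors then meet the amalgamated subgroup [<c>] in the same set, so an element of
    [P] is a power of [c] or an alternating product of elements of [M_X] and [M_Y]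
    outside [<c>].  By the normal form theorem, [g_1 ... g_n] lies in [P] iff some
    [c^k_1, ..., c^k_(n-1)] can be inserted to move the [g_i] into [M_X] or [M_Y];
    because [c] lies in [P], each set of admissible [k_i] is closed upwards, and
    non-membership has a finite certificate built from conditions such as
    [g \notin <c> M_X <c>], which are regular in the reduced word [g] by Benois.  Hence
    [P] and its complement are both recursively enumerable.

    In the inverse monoid, [u = v] and [u u^-1 = 1].  Replacing syllables by powers of
    [c] can only go up in the natural order, so the same normal forms show that a word
    equal in [G] to a reduced word [g] over one of the alphabets lies below [g].  This
    gives E-unitarity, and it reduces the word problem to that of [G] and to membership
    in [P] (Ivanov-Margolis-Meakin). *)

(** * Recursive functions *)

(** The algorithm never computes a normal form. Coset representatives modulo [<c>] are picked by
    choice and serve only to prove correctness; the enumeration runs through the words equal in [G]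
    to the input until one of them carries a certificate. Whether some prefixes generate the inverse
    of [c], and which sets the automata of Benois pass through, is likewise settled by classical
    logic: for fixed [u] and [v] these are finite data, built into the recursive function.

    The generators are enlarged because a product of elements of [M_X] may collapse to a negative
    power of [c], which a neighbouring element of [M_Y] must then absorb. If only one of the two
    sides contained that power, [P] would meet the other factor in more than its submonoid, and
    normal forms would no longer detect membership.

    In the inverse monoid a word is only below its free reduction. The argument on alternating
    products survives because it uses relations in one direction only, so a compatible preorder can
    replace equality. *)

Definition recursive1 (f : nat -> nat) := recursive (fun t : 1.-tuple nat => f (thead t)).

Definition recursive2 (f : nat -> nat -> nat) :=
  recursive (fun t : 2.-tuple nat => f (tnth t ord0) (tnth t ord_max)).

Lemma recursive_comp1 n f (g : n.-tuple nat -> nat) :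
  recursive1 f -> recursive g -> recursive (fun t => f (g t)).
Proof.
move=> rf rg; have := rec_comp rf (fun _ : 'I_1 => rg).
by apply: rec_ext => t; rewrite /thead tnth_mktuple.
Qed.

Lemma recursive_comp2 n f (g h : n.-tuple nat -> nat) :
  recursive2 f -> recursive g -> recursive h -> recursive (fun t => f (g t) (h t)).
Proof.
move=> rf rg rh.
have rgh (i : 'I_2) : recursive (if i == ord0 then g else h) by case: ifP.
by have := rec_comp rf rgh; apply: rec_ext => t; rewrite !tnth_mktuple.
Qed.

Lemma recursive_const n c : recursive (fun _ : n.-tuple nat => c).
Proof.
elim: c => [|c IHc]; first exact: rec_zero.
exact: (recursive_comp1 (f := succn) rec_succ IHc).
Qed.

Lemma recursive_thead n : recursive (fun t : n.+1.-tuple nat => thead t).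
Proof. exact: rec_proj. Qed.

Lemma recursive_tnth1 n : recursive (fun t : n.+2.-tuple nat => thead [tuple of behead t]).
Proof.
apply: rec_ext (rec_proj (lift ord0 ord0)) => t.
by case/tupleP: t => a t; case/tupleP: t => b t; rewrite !(tnth_nth 0).
Qed.

Lemma tnth_max2 (t : 2.-tuple nat) : tnth t ord_max = thead [tuple of behead t].
Proof. by case/tupleP: t => a t; case/tupleP: t => b t; rewrite !(tnth_nth 0). Qed.

Lemma recursive2P f :
  recursive (fun t : 2.-tuple nat => f (thead t) (thead [tuple of behead t])) -> recursive2 f.
Proof. by apply: rec_ext => t; rewrite -tnth_max2. Qed.

Lemma recursive1_iter f : recursive1 f -> recursive2 (fun n s => iter n f s).
Proof.
move=> rf; apply: recursive2P.
have rg := recursive_comp1 rf (@recursive_tnth1 1).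
apply: rec_ext (rec_prim (@recursive_thead 0) rg) => t /=.
by elim: (thead t) => //= n ->.
Qed.

Lemma recursive_iter n f (N g : n.-tuple nat -> nat) :
  recursive1 f -> recursive N -> recursive g -> recursive (fun t => iter (N t) f (g t)).
Proof. by move/recursive1_iter/recursive_comp2; apply. Qed.

Lemma recursive_succ n (g : n.-tuple nat -> nat) :
  recursive g -> recursive (fun t => (g t).+1).
Proof. exact: recursive_comp1 rec_succ. Qed.

Lemma recursive_add n (g h : n.-tuple nat -> nat) :
  recursive g -> recursive h -> recursive (fun t => g t + h t).
Proof.
move=> rg rh; have := recursive_iter (f := succn) rec_succ rg rh.
by apply: rec_ext => t; rewrite iter_succn addnC.
Qed.

Lemma recursive_mul n (g h : n.-tuple nat -> nat) :
  recursive g -> recursive h -> recursive (fun t => g t * h t).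
Proof.
apply: (recursive_comp2 (f := muln)); apply: recursive2P.
have rg : recursive (fun t : 3.-tuple nat => thead [tuple of behead t] + tnth t ord_max).
  by apply: recursive_add (rec_proj _); apply: recursive_tnth1.
apply: rec_ext (rec_prim (rec_zero 1) rg) => t /=.
elim: (thead t) => //= k ->; rewrite mulSn addnC; congr (_ + _).
by case/tupleP: t => a t; case/tupleP: t => b t; rewrite !(tnth_nth 0).
Qed.

Lemma recursive_pred n (g : n.-tuple nat -> nat) :
  recursive g -> recursive (fun t => (g t).-1).
Proof.
apply: (recursive_comp1 (f := predn)).
apply: rec_ext (rec_prim (rec_zero 0) (@recursive_thead 1)) => t.
by rewrite /=; case: (thead t).
Qed.

Lemma recursive_sub n (g h : n.-tuple nat -> nat) :
  recursive g -> recursive h -> recursive (fun t => g t - h t).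
Proof.
move=> rg rh; have := recursive_iter (f := predn) (recursive_pred (@recursive_thead 0)) rh rg.
by apply: rec_ext => t; elim: (h t) => [|k IHk] /=; rewrite ?subn0 // IHk subnS.
Qed.

Lemma recursive_eq0 n (g : n.-tuple nat -> nat) :
  recursive g -> recursive (fun t => nat_of_bool (g t == 0)).
Proof.
move=> rg; apply: rec_ext (recursive_sub (recursive_const n 1) rg) => t.
by case: (g t).
Qed.

Lemma recursive_exp2 n (g : n.-tuple nat -> nat) :
  recursive g -> recursive (fun t => 2 ^ g t).
Proof.
move=> rg; have rd : recursive1 double.
  by have := recursive_add (@recursive_thead 0) (@recursive_thead 0); apply: rec_ext => t; rewrite addnn.
apply: rec_ext (recursive_iter rd rg (recursive_const n 1)) => t.
by elim: (g t) => //= k ->; rewrite expnS mul2n.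
Qed.

Lemma recursive_min f : recursive2 f -> (forall x, exists k, f k x = 0) ->
  exists chi, recursive1 chi /\
    forall x, f (chi x) x = 0 /\ (forall k, f k x = 0 -> chi x <= k).
Proof.
move=> rf ex0; have reg (t : 1.-tuple nat) : exists k,
    (fun t : 2.-tuple nat => f (tnth t ord0) (tnth t ord_max)) [tuple of k :: t] == 0.
  by have [k fk] := ex0 (thead t); exists k; rewrite /= tnth_max2 [[tuple of behead _]](_ : _ = t) ?fk //; apply: val_inj.
exists (fun x => ex_minn (reg [tuple x])); split.
  apply: rec_ext (rec_mu reg rf) => t.
  by case/tupleP: t => a t; rewrite theadE (tuple0 t).
have tE k x : [tuple of k :: [tuple x]] = [tuple k; x] by apply: val_inj.
move=> x; case: ex_minnP => m /=; rewrite tE => /eqP fm min_m.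
by split=> // k fk; apply: min_m; rewrite tE /= fk.
Qed.

(** * Pairing *)

(** Pairing is consing on codes: the code of a non-empty word is the pair of its head and the code
    of its tail, while 0, the code of the empty word, is not a pair. *)
Definition pr (a b : nat) := CodeSeq.code [:: a & CodeSeq.decode b].

Lemma prE a b : pr a b = 2 ^ a * b.*2.+1.
Proof. by rewrite /pr /= CodeSeq.decodeK. Qed.

Lemma pr_neq0 a b : (pr a b == 0) = false.
Proof. by rewrite prE muln_eq0 expn_eq0. Qed.

Definition hd n := head 0 (CodeSeq.decode n).
Definition tl n := CodeSeq.code (behead (CodeSeq.decode n)).

Lemma hd_pr a b : hd (pr a b) = a.
Proof. by rewrite /hd /pr CodeSeq.codeK. Qed.

Lemma tl_pr a b : tl (pr a b) = b.
Proof. by rewrite /tl /pr CodeSeq.codeK /= CodeSeq.decodeK. Qed.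

Lemma pr_hd_tl n : n <> 0 -> pr (hd n) (tl n) = n.
Proof.
rewrite /pr /hd /tl CodeSeq.codeK -{1 4}[n]CodeSeq.decodeK.
by case: (CodeSeq.decode n).
Qed.

Lemma recursive_pr n (g h : n.-tuple nat -> nat) :
  recursive g -> recursive h -> recursive (fun t => pr (g t) (h t)).
Proof.
move=> rg rh; have r := recursive_mul (recursive_exp2 rg) (recursive_succ (recursive_add rh rh)).
by apply: rec_ext r => t; rewrite prE addnn.
Qed.

Lemma recursive_half n (g : n.-tuple nat -> nat) :
  recursive g -> recursive (fun t => (g t)./2).
Proof.
apply: (recursive_comp1 (f := half)).
(* The half of [n] is the least [k] with [n - 2k] at most 1. *)
pose f k n := (n - k.*2).-1.
have rf : recursive2 f.
  apply: recursive_pred; apply: recursive_sub; first exact: rec_proj.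
  apply: rec_ext (recursive_add (rec_proj ord0) (rec_proj ord0)) => t.
  by rewrite addnn.
have [|chi [rchi chiP]] := recursive_min rf.
  by move=> x; exists x; rewrite /f; lia.
apply: rec_ext rchi => t; have [] := chiP (thead t); rewrite /f.
set x := thead t => fx /(_ x./2); lia.
Qed.

Lemma recursive_hd_tl : recursive1 hd /\ recursive1 tl.
Proof.
(* The quotient of [x] by [2^(k+1)]: the second component of [x] when the first one is [k]. *)
pose m k x := (iter k half x)./2.
have rm n (g h : n.-tuple nat -> nat) : recursive g -> recursive h ->
    recursive (fun t => m (g t) (h t)).
  have rhalf := recursive_half (@recursive_thead 0).
  by move=> rg rh; apply: recursive_half; apply: recursive_iter.
have mP a b : m a (pr a b) = b.
  rewrite prE /m; suff -> : iter a half (2 ^ a * b.*2.+1) = b.*2.+1 by rewrite /= uphalf_double.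
  elim: a => [|a IHa]; rewrite ?mul1n // iterSr expnS -mulnA mul2n doubleK; exact: IHa.
(* Vanishes iff [x] is 0 or a pair with first component [k]; for [x = 0] the least such [k] is 0,
   which is [hd 0]. *)
pose f k x := nat_of_bool (nat_of_bool ((x - pr k (m k x)) + (pr k (m k x) - x) == 0) * (x != 0) + (x == 0) == 0).
have fP k x : (f k x = 0) <-> (x <> 0 -> k = hd x).
  rewrite /f; case: (x =P 0) => [->|x0]; first by rewrite muln0.
  rewrite muln1 addn0; split; last first.
    move=> /(_ x0) ->; have -> : m (hd x) x = tl x by rewrite -{2}(pr_hd_tl x0) mP.
    by rewrite pr_hd_tl // subnn.
  move=> fx _; have <- : pr k (m k x) = x; last by rewrite hd_pr.
  by move: fx; case: eqP => //; lia.
have rf : recursive2 f.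
  apply: recursive_eq0; apply: recursive_add; last first.
    by apply: recursive_eq0; apply: rec_proj.
  have rx := @rec_proj 2 ord_max; have rk := @rec_proj 2 ord0.
  apply: recursive_mul.
    apply: recursive_eq0; have rp := recursive_pr rk (rm _ _ _ rk rx).
    by apply: recursive_add; apply: recursive_sub.
  apply: rec_ext (recursive_eq0 (recursive_eq0 rx)) => t.
  by case: (tnth t ord_max).
have [|chi [rchi chiP]] := recursive_min rf.
  by move=> x; exists (hd x); apply/fP.
have rhd : recursive1 hd.
  apply: rec_ext rchi => t; have [/fP fx] := chiP (thead t).
  case: (thead t =P 0) => [-> /(_ 0)|/fx //].
  by rewrite (_ : hd 0 = 0) // => h; apply/eqP; rewrite -leqn0 h.
split=> //; pose g x := m (hd x) x.
apply: rec_ext (rm _ _ _ rhd (@recursive_thead 0)) => t.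
case: (thead t =P 0) => [-> //|x0].
by rewrite -{2}(pr_hd_tl x0) mP.
Qed.

Lemma recursive_hd n (g : n.-tuple nat -> nat) : recursive g -> recursive (fun t => hd (g t)).
Proof. by apply: recursive_comp1; case: recursive_hd_tl. Qed.

Lemma recursive_tl n (g : n.-tuple nat -> nat) : recursive g -> recursive (fun t => tl (g t)).
Proof. by apply: recursive_comp1; case: recursive_hd_tl. Qed.

(** * Recursively enumerable predicates *)

Definition re (P : nat -> Prop) := exists2 f, recursive2 f & forall x, P x <-> exists k, f k x = 0.

Ltac recursive_solve :=
  repeat first [ assumption | exact: rec_proj | exact: recursive_thead | exact: recursive_const
  | match goal with
    | r : recursive1 _ |- _ => apply: (recursive_comp1 r)
    | r : recursive2 _ |- _ => apply: (recursive_comp2 r)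
    end
  | apply: recursive_pr | apply: recursive_hd | apply: recursive_tl | apply: recursive_add
  | apply: recursive_mul | apply: recursive_sub | apply: recursive_eq0 | apply: recursive_succ ].

Lemma re_ext P Q : re P -> (forall x, P x <-> Q x) -> re Q.
Proof. by case=> f rf fP PQ; exists f => // x; rewrite -PQ. Qed.

Lemma re_preim P f : re P -> recursive1 f -> re (fun x => P (f x)).
Proof.
case=> g rg gP rf; exists (fun k x => g k (f x)) => [|x]; last exact: gP.
by rewrite /recursive2; recursive_solve.
Qed.

Lemma re_and P Q : re P -> re Q -> re (fun x => P x /\ Q x).
Proof.
case=> f rf fP [g rg gP]; exists (fun k x => f (hd k) x + g (tl k) x).
  by rewrite /recursive2; recursive_solve.
move=> x; rewrite fP gP; split=> [[[i fi] [j gj]]|[k /eqP]].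
  by exists (pr i j); rewrite hd_pr tl_pr fi gj.
by rewrite addn_eq0 => /andP[/eqP fk /eqP gk]; split; [exists (hd k) | exists (tl k)].
Qed.

Lemma re_or P Q : re P -> re Q -> re (fun x => P x \/ Q x).
Proof.
case=> f rf fP [g rg gP]; exists (fun k x => f k x * g k x).
  by rewrite /recursive2; recursive_solve.
move=> x; rewrite fP gP; split=> [[[k fk]|[k gk]]|[k /eqP]].
- by exists k; rewrite fk.
- by exists k; rewrite gk muln0.
- by rewrite muln_eq0 => /orP[] /eqP; [left | right]; exists k.
Qed.

Lemma re_ex P : re (fun z => P (hd z) (tl z)) -> re (fun x => exists y, P x y).
Proof.
case=> f rf fP; exists (fun k x => f (hd k) (pr x (tl k))).
  by rewrite /recursive2; recursive_solve.
have {}fP x y : P x y <-> exists k, f k (pr x y) = 0 by rewrite -fP hd_pr tl_pr.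
move=> x; split=> [[y /fP[k fk]]|[k fk]].
  by exists (pr k y); rewrite hd_pr tl_pr.
by exists (tl k); apply/fP; exists (hd k).
Qed.

Lemma re_eq f g : recursive1 f -> recursive1 g -> re (fun x => f x = g x).
Proof.
move=> rf rg; exists (fun _ x => (f x - g x) + (g x - f x)).
  by rewrite /recursive2; recursive_solve.
by move=> x; split=> [->|[_]]; [exists 0; rewrite subnn | lia].
Qed.

Lemma re_False : re (fun _ => False).
Proof. by exists (fun _ _ => 1) => [|x]; [exact: recursive_const | split=> // -[]]. Qed.

Lemma re_has (I : eqType) (r : seq I) P : (forall i, re (P i)) ->
  re (fun x => exists2 i, i \in r & P i x).
Proof.
move=> reP; elim: r => [|i r IHr]; first by apply: re_ext re_False _ => x; split=> // -[].
apply: re_ext (re_or (reP i) IHr) _ => x; split=> [[Pi|[j rj Pj]]|[j]].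
- by exists i; rewrite ?mem_head.
- by exists j; rewrite // inE rj orbT.
- by rewrite inE => /orP[/eqP->|rj Pj]; [left | right; exists j].
Qed.

Lemma ltn_pr a b : b < pr a b.
Proof. by rewrite prE; have := expn_gt0 2 a; nia. Qed.

(** * Reflexive transitive closure of an enumerable relation *)

Section ReStar.
Variables (R : nat -> nat -> Prop) (f : nat -> nat -> nat).
Hypothesis fP : forall x y, R x y <-> exists k, f k (pr x y) = 0.

(* A state [pr e (pr x l)] stands for a current point [x], a list [l] of pairs
   (witness, next point) still to be followed, and a count [e] of failures. *)
Let step (s : nat) : nat :=
  let x := hd (tl s) in let l := tl (tl s) in let y := tl (hd l) in
  let b := nat_of_bool (l == 0) in
  pr (hd s + (1 - b) * f (hd (hd l)) (pr x y)) (pr (b * x + (1 - b) * y) (tl l)).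

Let step_nil e x : step (pr e (pr x 0)) = pr e (pr x 0).
Proof. by rewrite /step !(hd_pr, tl_pr) /= addn0 mul1n addn0. Qed.

Let step_cons e x l : l <> 0 ->
  step (pr e (pr x l)) = pr (e + f (hd (hd l)) (pr x (tl (hd l)))) (pr (tl (hd l)) (tl l)).
Proof. by move=> /eqP/negPf l0; rewrite /step !(hd_pr, tl_pr) l0 /= !mul1n. Qed.

Let iter_nil n e x : iter n step (pr e (pr x 0)) = pr e (pr x 0).
Proof. by elim: n => //= n ->; rewrite step_nil. Qed.

Let iter_sound n e x l : hd (iter n step (pr e (pr x l))) = 0 ->
  e = 0 /\ clos_refl_trans_1n _ R x (hd (tl (iter n step (pr e (pr x l))))).
Proof.
elim: n e x l => [|n IHn] e x l /=.
  by rewrite hd_pr tl_pr hd_pr; split=> //; apply: rt1n_refl.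
rewrite -iterS iterSr; case: (l =P 0) => [->|l0]; first by rewrite step_nil; apply: IHn.
rewrite (step_cons _ _ l0) => /IHn[/eqP].
rewrite addn_eq0 => /andP[/eqP e0 /eqP f0] st; split=> //.
by apply: rt1n_trans st; apply/fP; exists (hd (hd l)).
Qed.

Let iter_complete x y : clos_refl_trans_1n _ R x y ->
  exists l, forall n, l <= n -> exists l', iter n step (pr 0 (pr x l)) = pr 0 (pr y l').
Proof.
elim=> {x y} [x|x y z /fP[k fk] _ [l lP]].
  by exists 0 => n _; exists 0; rewrite iter_nil.
exists (pr (pr k y) l) => -[|n]; first by rewrite leqn0 pr_neq0.
move/(leq_trans (ltn_pr _ _)) => /lP[l' E]; exists l'.
by rewrite iterSr step_cons ?hd_pr ?tl_pr ?fk ?hd_pr //; apply/eqP; rewrite pr_neq0.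
Qed.

Lemma recursive_star : recursive2 f ->
  re (fun z => clos_refl_trans_1n _ R (hd z) (tl z)).
Proof.
move=> rf; have rstep : recursive1 step by rewrite /recursive1 /step; recursive_solve.
pose r k z := iter k step (pr 0 (pr (hd z) k)).
exists (fun k z => hd (r k z) + ((hd (tl (r k z)) - tl z) + (tl z - hd (tl (r k z))))).
  have rr : recursive2 r by apply: recursive_iter; recursive_solve.
  by rewrite /recursive2; recursive_solve.
move=> z; split=> [/iter_complete[l /(_ l (leqnn l))[l' rE]]|[k]].
  by exists l; rewrite /r rE hd_pr tl_pr hd_pr subnn.
move/eqP; rewrite addn_eq0 => /andP[/eqP r0 rz]; have [_] := iter_sound r0.
by rewrite -/(r k z) (_ : hd (tl _) = tl z) //; lia.
Qed.
End ReStar.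

Lemma re_star R : re (fun z => R (hd z) (tl z)) ->
  re (fun z => clos_refl_trans_1n _ R (hd z) (tl z)).
Proof.
case=> f rf fP; apply: recursive_star rf => x y.
by have := fP (pr x y); rewrite hd_pr tl_pr.
Qed.

(** Post's theorem: the product of the two test functions always has a zero, and the least one tells
    which side holds. *)
Lemma re_decidable P : re P -> re (fun x => ~ P x) ->
  exists2 chi, recursive1 chi & forall x, P x /\ chi x = 1 \/ ~ P x /\ chi x = 0.
Proof.
case=> f rf fP [g rg gP].
have rfg : recursive2 (fun k x => f k x * g k x) by rewrite /recursive2; recursive_solve.
have [|mu [rmu muP]] := recursive_min rfg.
  move=> x; case: (pselect (P x)) => [/fP|/gP] [k fk]; exists k; by rewrite fk ?muln0.
exists (fun x => nat_of_bool (f (mu x) x == 0)).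
  by rewrite /recursive1; recursive_solve.
move=> x; have [/eqP + _] := muP x; rewrite muln_eq0; case: eqP => [fx _|nfx /= /eqP gx].
  by left; split=> //; apply/fP; exists (mu x).
by right; split=> //; apply/gP; exists (mu x).
Qed.

(** * Recursively enumerable predicates on encoded types *)

(** Both the codes and the non-codes are enumerable, so that an enumerable complement in [T] gives
    an enumerable complement among all naturals. *)
Class encodable (T : Type) := Encodable {
  enc : T -> nat;
  enc_injective : injective enc;
  re_enc : re (fun n => exists x, n = enc x);
  re_not_enc : re (fun n => ~ exists x, n = enc x)
}.

Lemma enc_inj T {eT : encodable T} (x y : T) : enc x = enc y -> x = y.
Proof. exact: enc_injective. Qed.

Definition RE T {_ : encodable T} (P : T -> Prop) := re (fun n => exists2 x, n = enc x & P x).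

Definition computable T U {_ : encodable T} {_ : encodable U} (f : T -> U) :=
  exists2 g, recursive1 g & forall x, g (enc x) = enc (f x).

Program Instance encodable_prod T U {_ : encodable T} {_ : encodable U} : encodable (T * U) :=
  {| enc := fun x => pr (enc x.1) (enc x.2) |}.
Next Obligation.
move=> [x y] [x' y'] /= E.
have Ex : enc x = enc x' by rewrite -[enc x](hd_pr _ (enc y)) E hd_pr.
have Ey : enc y = enc y' by rewrite -[enc y](tl_pr (enc x)) E tl_pr.
by rewrite (enc_inj Ex) (enc_inj Ey).
Qed.
Next Obligation.
have rpr : recursive1 (fun n => pr (hd n) (tl n)) by rewrite /recursive1; recursive_solve.
have rid : recursive1 id by apply: recursive_thead.
have [rhd rtl] := recursive_hd_tl.
apply: re_ext (re_and (re_eq rpr rid) (re_and (re_preim (@re_enc T _) rhd) (re_preim (@re_enc U _) rtl))) _.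
move=> n /=; split=> [[<- [[x nx] [y ny]]]|[[x y] ->]] /=.
  by exists (x, y); rewrite -nx -ny hd_pr tl_pr.
by rewrite hd_pr tl_pr; split=> //; split; [exists x | exists y].
Qed.
Next Obligation.
have r0 : re (fun n => n = 0).
  by apply: re_eq; [apply: recursive_thead | apply: recursive_const].
have [rhd rtl] := recursive_hd_tl.
apply: re_ext (re_or r0 (re_or (re_preim (@re_not_enc T _) rhd) (re_preim (@re_not_enc U _) rtl))) _.
move=> n /=; split=> [[->|[]]|nenc].
- by case=> z /esym/eqP; rewrite pr_neq0.
- by move=> nT [z nE]; apply: nT; exists z.1; rewrite nE hd_pr.
- by move=> nU [z nE]; apply: nU; exists z.2; rewrite nE tl_pr.
case: (n =P 0) => [|n0]; [by left | right].
case: (pselect (exists x : T, hd n = enc x)) => [[x nx]|]; [right => -[y ny] | by left].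
by apply: nenc; exists (x, y); rewrite -nx -ny pr_hd_tl.
Qed.

Section RE.
Context {T U V : Type} {eT : encodable T} {eU : encodable U} {eV : encodable V}.

Lemma RE_ext (P Q : T -> Prop) : RE P -> (forall x, P x <-> Q x) -> RE Q.
Proof.
move=> reP PQ; apply: re_ext reP _ => n.
by split=> -[x -> /PQ]; exists x.
Qed.

Lemma RE_preim (P : U -> Prop) (f : T -> U) : RE P -> computable f -> RE (fun x => P (f x)).
Proof.
move=> reP [g rg gP]; apply: re_ext (re_and (@re_enc T _) (re_preim reP rg)) _ => n.
split=> [[[x ->] [y]]|[x -> Pfx]]; last by split; [exists x | exists (f x)].
by rewrite gP => E Pfx; exists x; rewrite // (enc_inj E).
Qed.

Lemma RE_and (P Q : T -> Prop) : RE P -> RE Q -> RE (fun x => P x /\ Q x).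
Proof.
move=> reP reQ; apply: re_ext (re_and reP reQ) _ => n.
split=> [[[x -> Px] [y E Qy]]|[x -> [Px Qx]]].
  by exists x; rewrite // {2}(enc_inj E).
by split; exists x.
Qed.

Lemma RE_or (P Q : T -> Prop) : RE P -> RE Q -> RE (fun x => P x \/ Q x).
Proof.
move=> reP reQ; apply: re_ext (re_or reP reQ) _ => n.
by split=> [[] [x -> Px]|[x -> [] Px]]; [exists x; auto.. | left | right]; exists x.
Qed.

Lemma RE_has (I : eqType) (r : seq I) (P : I -> T -> Prop) :
  (forall i, RE (P i)) -> RE (fun x => exists2 i, i \in r & P i x).
Proof.
move=> /(@re_has I r) reP; apply: re_ext reP _ => n.
by split=> [[i ri [x -> Px]]|[x -> [i ri Px]]]; [exists x => //; exists i | exists i => //; exists x].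
Qed.

Lemma RE_ex (P : T -> U -> Prop) : RE (fun z => P z.1 z.2) -> RE (fun x => exists y, P x y).
Proof.
move=> reP; pose Q m n := exists2 z : T * U, pr m n = pr (@enc T eT z.1) (@enc U eU z.2) & P z.1 z.2.
have rpr : recursive1 (fun n => pr (hd n) (tl n)) by rewrite /recursive1; recursive_solve.
have reQ : re (fun m => exists n, Q m n) by apply: re_ex; apply: re_preim reP rpr.
apply: re_ext (re_and (@re_enc T _) reQ) _ => n; split.
  case=> -[x ->] [m [[x' y] /= E Pxy]]; exists x => //; exists y.
  have Ex : enc x = enc x' by rewrite -[enc x](hd_pr _ m) E hd_pr.
  by rewrite (enc_inj Ex).
by case=> x -> [y Pxy]; split; [exists x | exists (enc y), (x, y)].
Qed.

Lemma RE_eq (f g : T -> U) : computable f -> computable g -> RE (fun x => f x = g x).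
Proof.
move=> [f' rf fP] [g' rg gP]; apply: re_ext (re_and (@re_enc T _) (re_eq rf rg)) _ => n.
split=> [[[x ->]]|[x -> E]]; first by rewrite fP gP => E; exists x; rewrite // (enc_inj E).
by split; [exists x | rewrite fP gP E].
Qed.

Lemma RE_True : RE (fun _ : T => True).
Proof. by apply: re_ext (@re_enc T _) _ => n; split=> [[x ->]|[x -> _]]; exists x. Qed.

Lemma computable_id : computable (id : T -> T).
Proof. by exists id => //; apply: recursive_thead. Qed.

Lemma computable_const (c : U) : computable (fun _ : T => c).
Proof. by exists (fun _ => enc c) => //; apply: recursive_const. Qed.

Lemma computable_fst (f : T -> U * V) : computable f -> computable (fun x => (f x).1).
Proof.
case=> g rg gP; exists (fun n => hd (g n)) => [|x]; last by rewrite gP hd_pr.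
by rewrite /recursive1; recursive_solve.
Qed.

Lemma computable_snd (f : T -> U * V) : computable f -> computable (fun x => (f x).2).
Proof.
case=> g rg gP; exists (fun n => tl (g n)) => [|x]; last by rewrite gP tl_pr.
by rewrite /recursive1; recursive_solve.
Qed.

Lemma computable_pair (f : T -> U) (g : T -> V) :
  computable f -> computable g -> computable (fun x => (f x, g x)).
Proof.
case=> f' rf fP [g' rg gP]; exists (fun n => pr (f' n) (g' n)) => [|x]; last by rewrite fP gP.
by rewrite /recursive1; recursive_solve.
Qed.
End RE.

Lemma RE_star T {eT : encodable T} (R : T -> T -> Prop) :
  RE (fun z => R z.1 z.2) -> RE (fun z => clos_refl_trans_1n _ R z.1 z.2).
Proof.
pose R0 m n := exists2 z : T * T, pr m n = pr (@enc T eT z.1) (@enc T eT z.2) & R z.1 z.2.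
move=> reR; have reR0 : re (fun z => R0 (hd z) (tl z)).
  have rpr : recursive1 (fun n => pr (hd n) (tl n)) by rewrite /recursive1; recursive_solve.
  by apply: re_ext (re_preim reR rpr) _ => n.
apply: re_ext (re_and (@RE_True (T * T) _) (re_star reR0)) _ => n.
have inv m x n' : clos_refl_trans_1n _ R0 m n' -> m = enc x ->
    exists2 y, n' = enc y & clos_refl_trans_1n _ R x y.
  move=> st; elim: st x => {m n'} [m|m k p [[x y] /= E Rxy] _ IH] x' Em.
    by exists x' => //; apply: rt1n_refl.
  have [Ex Ey] : m = enc x /\ k = enc y by rewrite -(hd_pr m k) -{2}(tl_pr m k) E hd_pr tl_pr.
  have [z -> st] := IH _ Ey; exists z => //; apply: rt1n_trans st.
  by rewrite (enc_inj (etrans (esym Em) Ex)).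
split=> [[[[x y] -> _] /=]|[[x y] -> /= st]].
  rewrite hd_pr tl_pr => /inv /(_ erefl)[z E st].
  by exists (x, y); rewrite //= (enc_inj E).
split; [by exists (x, y) | rewrite hd_pr tl_pr].
elim: st => {x y} [x|x y z Rxy _ IH]; first exact: rt1n_refl.
by apply: rt1n_trans IH; exists (x, y).
Qed.

Program Instance encodable_fin (T : finType) : encodable T :=
  {| enc := fun x => enum_rank x |}.
Next Obligation. by move=> x y /ord_inj /enum_rank_inj. Qed.
Next Obligation.
have reE (i : T) : re (fun n => n = enum_rank i).
  by apply: re_eq; [apply: recursive_thead | apply: recursive_const].
by apply: re_ext (re_has (enum T) reE) _ => n; split=> [[i _ ->]|[i ->]]; exists i; rewrite ?mem_enum.
Qed.
Next Obligation.
have rlt : re (fun n => #|T| - n = 0).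
  by apply: re_eq; rewrite /recursive1; recursive_solve.
apply: re_ext rlt _ => n; split=> [/eqP|].
  by rewrite subn_eq0 => + [x nx]; rewrite nx leqNgt ltn_ord.
move=> nT; apply/eqP; rewrite subn_eq0 leqNgt; apply/negP => nltT; apply: nT.
by exists (enum_val (Ordinal nltT)); rewrite enum_valK.
Qed.

Lemma code_seq_cons (A : finType) (a : A) s : code_seq (a :: s) = pr (enum_rank a) (code_seq s).
Proof. by rewrite prE. Qed.

Program Instance encodable_seq (A : finType) : encodable (seq A) := {| enc := @code_seq A |}.
Next Obligation.
move=> s t /(can_inj CodeSeq.codeK); apply: inj_map => x y.
by move/ord_inj/enum_rank_inj.
Qed.
Next Obligation.
(* Codes of words are the numbers reached from 0 by pairing letters on the left. *)
pose R x y := exists2 a : A, a \in enum A & y = pr (enum_rank a) x.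
have reR : re (fun z => R (hd z) (tl z)).
  apply: re_has => a; have [rhd rtl] := recursive_hd_tl; apply: re_eq => //.
  by rewrite /recursive1; recursive_solve.
have r0 : recursive1 (fun n => pr 0 n) by rewrite /recursive1; recursive_solve.
apply: re_ext (re_preim (re_star reR) r0) _ => n; rewrite hd_pr tl_pr; split.
  rewrite -[0]/(code_seq (@nil A)); move E: (code_seq _) => m st.
  elim: st [::] E => {m n} [m s <-|m k n [a _ ->] _ IH s sm]; first by exists s.
  by apply: (IH (a :: s)); rewrite code_seq_cons sm.
case=> s ->; elim: s => [|a s IHs]; first exact: rt1n_refl.
apply/clos_rt_rt1n; apply: rt_trans (clos_rt1n_rt _ _ _ _ IHs) _; apply: rt_step.
by exists a; rewrite ?mem_enum ?code_seq_cons.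
Qed.

Next Obligation.
pose R x y := exists a, y = pr a x.
have reR : re (fun z => R (hd z) (tl z)).
  by apply: re_ex; apply: re_eq; rewrite /recursive1; recursive_solve.
(* A number codes no word iff stripping off heads reaches a pair whose head is at least [#|A|],
   hence not the rank of a letter. *)
have reN : re (fun n => exists x, exists a, clos_refl_trans_1n _ R (pr (a + #|A|) x) n).
  apply: re_ex; apply: re_ex.
  have rg : recursive1 (fun n => pr (pr (tl n + #|A|) (tl (hd n))) (hd (hd n))).
    by rewrite /recursive1; recursive_solve.
  by apply: re_ext (re_preim (re_star reR) rg) _ => n; rewrite hd_pr tl_pr.
apply: re_ext reN _ => n; split.
  case=> y [a st]; move E: (pr _ _) st => m st.
  have {E} : ~ exists s : seq A, m = code_seq s.
    case=> -[|b s]; rewrite -E; first by apply/eqP; rewrite pr_neq0.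
    rewrite code_seq_cons => /(congr1 hd); rewrite !hd_pr => ab.
    by have := ltn_ord (enum_rank b); rewrite -ab ltnNge leq_addl.
  elim: st => // {m n} m k n [b ->] _ IH mA; apply: IH => -[[|c s]].
    by apply/eqP; rewrite pr_neq0.
  by rewrite code_seq_cons => /(congr1 tl); rewrite !tl_pr => mE; apply: mA; exists s.
elim/ltn_ind: n => n IHn nA.
case: (n =P 0) => [n0|/pr_hd_tl nE]; first by case: nA; exists [::].
case: (leqP #|A| (hd n)) => [leA|ltA].
  by exists (tl n), (hd n - #|A|); rewrite subnK // nE; apply: rt1n_refl.
have [||y [a st]] := IHn (tl n); first by rewrite -{2}nE ltn_pr.
  case=> s tE; apply: nA; exists (enum_val (Ordinal ltA) :: s).
  by rewrite code_seq_cons enum_valK -tE.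
exists y, a; apply/clos_rt_rt1n; apply: rt_trans (clos_rt1n_rt _ _ _ _ st) _; apply: rt_step.
by exists (hd n).
Qed.

Section Words.
Context {T : Type} {eT : encodable T} {A : finType}.

Lemma computable_cons (a : A) (f : T -> seq A) : computable f -> computable (fun x => a :: f x).
Proof.
case=> g rg gP; exists (fun n => pr (enum_rank a) (g n)) => [|x].
  by rewrite /recursive1; recursive_solve.
by rewrite gP /= -code_seq_cons.
Qed.

Lemma computable_cat (f g : T -> seq A) :
  computable f -> computable g -> computable (fun x => f x ++ g x).
Proof.
(* [step] moves the head of the first list onto the second and stalls once the first is empty; the
   code of the first list bounds its length. Concatenation is then two such reversals. *)
pose step st := let b := nat_of_bool (hd st == 0) in
  pr (tl (hd st)) (b * tl st + (1 - b) * pr (hd (hd st)) (tl st)).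
pose rcat s t := tl (iter s step (pr s t)).
have rcatE (s t : seq A) : rcat (code_seq s) (code_seq t) = code_seq (rev s ++ t).
  rewrite /rcat; move: (leqnn (code_seq s)); move: {2 3}(code_seq s) => n.
  elim: n s t => [|n IHn] [|a s] t.
  - by rewrite /= tl_pr.
  - by rewrite code_seq_cons leqn0 pr_neq0.
  - move=> _; rewrite iterSr /step !(hd_pr, tl_pr) /= mul1n addn0.
    exact: (IHn [::]).
  rewrite code_seq_cons => /(leq_trans (ltn_pr _ _)) /(IHn _ (a :: t)).
  rewrite iterSr {3}/step !(hd_pr, tl_pr) pr_neq0 /= mul0n mul1n add0n.
  by rewrite -code_seq_cons rev_cons cat_rcons.
have rstep : recursive1 step by rewrite /recursive1 /step; recursive_solve.
have rrcat : recursive2 rcat.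
  by apply: recursive_tl; apply: recursive_iter; recursive_solve.
case=> f' rf fP [g' rg gP]; exists (fun n => rcat (rcat (f' n) (code_seq (@nil A))) (g' n)).
  by rewrite /recursive1; recursive_solve.
by move=> x; rewrite fP gP /= !rcatE cats0 revK.
Qed.
End Words.

Ltac computable_solve :=
  repeat first [ exact: computable_const | exact: computable_id
  | apply: computable_fst | apply: computable_snd | apply: computable_pair
  | apply: computable_cons | apply: computable_cat ].

Lemma RE_decidable T {eT : encodable T} (P : T -> Prop) : RE P -> RE (fun x => ~ P x) ->
  exists2 chi, recursive1 chi &
    forall x, P x /\ chi (enc x) = 1 \/ ~ P x /\ chi (enc x) = 0.
Proof.
move=> reP reN; pose Q n := exists2 x, n = @enc T eT x & P x.
have reQ : re (fun n => ~ Q n).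
  apply: re_ext (re_or reN (@re_not_enc T _)) _ => n; split.
    case=> [[x ->] nPx [y E Py]|nE [x nx _]]; last by apply: nE; exists x.
    by apply: nPx; rewrite (enc_inj E).
  move=> nQ; case: (pselect (exists x, n = enc x)) => [[x nx]|]; [left | by right].
  by exists x => // Px; apply: nQ; exists x.
have [chi rchi chiP] := re_decidable reP reQ; exists chi => // x.
have [[[y E Py] chi1]|[nQ chi0]] := chiP (enc x).
  by left; split=> //; rewrite (enc_inj E).
by right; split=> // Px; apply: nQ; exists x.
Qed.

Lemma RE_decidable_set (A : finType) (P : seq A -> Prop) :
  RE P -> RE (fun s => ~ P s) -> decidable_set P.
Proof.
move=> reP /(RE_decidable reP)[chi rchi chiP].
by exists (fun t => chi (thead t)); split=> // s; rewrite theadE; apply: chiP.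
Qed.

Lemma RE_decidable_rel (A : finType) (E : seq A -> seq A -> Prop) :
  RE (fun z => E z.1 z.2) -> RE (fun z => ~ E z.1 z.2) -> decidable_rel E.
Proof.
move=> reP /(RE_decidable reP)[chi rchi chiP].
exists (fun t => chi (pr (tnth t ord0) (tnth t ord_max))); split.
  by recursive_solve.
by move=> s t; have := chiP (s, t); rewrite !(tnth_nth 0).
Qed.

Lemma RE_rel T U V {eT : encodable T} {eU : encodable U} {eV : encodable V}
    (R : U -> V -> Prop) (f : T -> U) (g : T -> V) :
  RE (fun z => R z.1 z.2) -> computable f -> computable g -> RE (fun x => R (f x) (g x)).
Proof.
by move=> reR cf cg; apply: (RE_preim (f := fun x => (f x, g x)) reR); apply: computable_pair.
Qed.

Section Congruence.
Variables (A : finType) (R : seq A -> seq A -> Prop).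

(** One replacement in context. It presents the congruence as a reflexive transitive closure, to
    which [RE_star] applies. *)
Definition rewrites (p q : seq A) :=
  exists x y l r, [/\ R l r \/ R r l, p = x ++ l ++ y & q = x ++ r ++ y].

Lemma congruence_rewrites p q :
  congruence_gen R p q <-> clos_refl_trans_1n _ rewrites p q.
Proof.
split=> [E|]; last first.
  elim=> {p q} [p|p q r [x [y [l [r' [Rlr -> ->]]]]] _ IH]; first exact: cg_refl.
  apply: cg_trans IH; apply: cg_cat; first exact: cg_refl.
  apply: cg_cat; last exact: cg_refl.
  by case: Rlr => Rlr; [|apply: cg_sym]; apply: cg_rel.
have cat_r x p' q' y : clos_refl_trans _ rewrites p' q' ->
    clos_refl_trans _ rewrites (x ++ p' ++ y) (x ++ q' ++ y).
  elim=> {p' q'} [p' q' [x' [y' [l [r [Rlr -> ->]]]]]|p'|p' q' r _ IH1 _ IH2].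
  - by apply: rt_step; exists (x ++ x'), (y' ++ y), l, r; rewrite -!catA.
  - exact: rt_refl.
  - exact: rt_trans IH1 IH2.
apply/clos_rt_rt1n; elim: E => {p q} [p q Rpq|p|p q _ IH|p q r _ IH1 _ IH2|p p' q q' _ IH1 _ IH2].
- by apply: rt_step; exists [::], [::], p, q; rewrite !cats0; split=> //; left.
- exact: rt_refl.
- elim: IH => {p q} [p q [x [y [l [r [Rlr -> ->]]]]]|p|p q r _ IH1 _ IH2].
  + by apply: rt_step; exists x, y, r, l; split=> //; apply/or_comm.
  + exact: rt_refl.
  + exact: rt_trans IH2 IH1.
- exact: rt_trans IH1 IH2.
- by apply: rt_trans (cat_r [::] _ _ q IH1) _; have := cat_r p' _ _ [::] IH2; rewrite !cats0.
Qed.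

Lemma RE_congruence :
  RE (fun z => R z.1 z.2) -> RE (fun z => congruence_gen R z.1 z.2).
Proof.
move=> reR; apply: RE_ext (_ : RE (fun z => clos_refl_trans_1n _ rewrites z.1 z.2)) _; last first.
  by move=> z; rewrite congruence_rewrites.
apply: RE_star; do 4 apply: RE_ex.
apply: (RE_ext (P := fun z => (R z.1.2 z.2 \/ R z.2 z.1.2) /\
   z.1.1.1.1.1 = z.1.1.1.2 ++ z.1.2 ++ z.1.1.2 /\ z.1.1.1.1.2 = z.1.1.1.2 ++ z.2 ++ z.1.1.2)).
  apply: RE_and; first by apply: RE_or; apply: RE_rel reR _ _; computable_solve.
  by apply: RE_and; apply: RE_eq; computable_solve.
by move=> z; split=> [[? []]|[]].
Qed.
End Congruence.

(** * Regular languages *)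

Section Regular.
Variable A : finType.

Definition regular (L : seq A -> Prop) :=
  exists (Q : finType) (d : Q -> A -> Q) (q0 : Q) (F : pred Q),
    forall s, L s <-> F (foldl d q0 s).

Lemma regular_ext L M : regular L -> (forall s, L s <-> M s) -> regular M.
Proof. by case=> Q [d [q0 [F LF]]] LM; exists Q, d, q0, F => s; rewrite -LM. Qed.

Lemma regular_not L : regular L -> regular (fun s => ~ L s).
Proof.
case=> Q [d [q0 [F LF]]]; exists Q, d, q0, (predC F) => s.
by rewrite LF; split=> /negP.
Qed.

Lemma regular_and L M : regular L -> regular M -> regular (fun s => L s /\ M s).
Proof.
case=> Q [d [q0 [F LF]]] [Q' [d' [q0' [F' MF]]]].
exists (Q * Q')%type, (fun q a => (d q.1 a, d' q.2 a)), (q0, q0'), (fun q => F q.1 && F' q.2) => s.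
rewrite LF MF; suff -> : foldl (fun q a => (d q.1 a, d' q.2 a)) (q0, q0') s =
  (foldl d q0 s, foldl d' q0' s) by apply: rwP andP.
by elim: s q0 q0' {LF MF} => //= a s IHs q q'; rewrite IHs.
Qed.

(** A step of the automaton is a finite disjunction over its transition table, so acceptance is the
    existence of a path for an enumerable relation. *)
Lemma RE_regular L : regular L -> RE L.
Proof.
case=> Q [d [q0 [F LF]]].
pose step (z z' : Q * seq A) := exists2 i : Q * A, i \in enum {: Q * A} &
  exists s, z = (i.1, i.2 :: s) /\ z' = (d i.1 i.2, s).
have re_step : RE (fun z => step z.1 z.2).
  by apply: RE_has => i; apply: RE_ex; apply: RE_and; apply: RE_eq; computable_solve.
have foldlP q s q' : foldl d q s = q' <-> clos_refl_trans_1n _ step (q, s) (q', [::]).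
  split=> [<-|].
    elim: s q => [|a s IHs] q; first exact: rt1n_refl.
    by apply: rt1n_trans (IHs _); exists (q, a); rewrite ?mem_enum //; exists s.
  move E : (q, s) => z; move E' : (q', [::]) => z' st.
  elim: st q s E E' => {z z'} [z q s <- [-> <-] //|].
  by move=> z z1 z2 [[q1 a] _ [s1 [-> ->]]] _ IH q s [-> ->] E'; apply: (IH _ _ erefl E').
apply: (RE_ext (P := fun s => exists2 q, q \in [seq q <- enum Q | F q] &
  clos_refl_trans_1n _ step (q0, s) (q, [::]))).
  by apply: RE_has => q; apply: RE_rel (RE_star re_step) _ _; computable_solve.
move=> s; rewrite LF; split=> [[q + /foldlP ->]|Fq].
  by rewrite mem_filter => /andP[].
by exists (foldl d q0 s); [rewrite mem_filter Fq mem_enum | apply/foldlP].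
Qed.

Lemma regular_all (P : pred A) : regular (fun s => all P s).
Proof.
exists bool, (fun b a => b && P a), true, id => s.
rewrite -[X in X <-> _]/(is_true (true && all P s)); elim: s true => [|a s IHs] b /=.
  by rewrite andbT.
by rewrite andbA IHs.
Qed.

Lemma regular_sorted (e : rel A) : regular (sorted e).
Proof.
pose d (q : option (option A)) a := match q with
  | Some (Some b) => if e b a then Some (Some a) else None
  | Some None => Some (Some a)
  | None => None end.
exists (option (option A)), d, (Some None), isSome => s.
have dN t : foldl d None t = None by elim: t.
case: s => //= a s; elim: s a => //= b s IHs a.
by case: (e a b) => //=; rewrite dN.
Qed.
End Regular.

(** * Words and presented groups *)

Lemma linvK Z : involutive (@linv Z).
Proof. by case=> z b; rewrite /linv /= negbK. Qed.

Lemma winv_cat Z (p q : word Z) : winv (p ++ q) = winv q ++ winv p.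
Proof. by rewrite /winv map_cat rev_cat. Qed.

Lemma winv_cons Z (a : letter Z) (p : word Z) : winv (a :: p) = winv p ++ [:: linv a].
Proof. by rewrite -cat1s winv_cat. Qed.

Lemma winvK Z : involutive (@winv Z).
Proof. by move=> p; rewrite /winv map_rev revK mapK //; apply: linvK. Qed.

#[export] Hint Extern 0 (gp_eq _ _ _) => exact: cg_refl : core.

Section PresentedGroup.
Variables (Z : Type) (w : word Z).
Local Notation "p ~~ q" := (gp_eq w p q) (at level 70).

Global Instance gp_eq_Equivalence : Equivalence (gp_eq w).
Proof.
split=> [p|p q|p q r]; [exact: cg_refl | exact: cg_sym | exact: cg_trans].
Qed.

Global Instance gp_eq_cat : Proper (gp_eq w ==> gp_eq w ==> gp_eq w) cat.
Proof. by move=> p p' pp' q q'; apply: cg_cat. Qed.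

Lemma gp_eq_refl p : p ~~ p. Proof. exact: cg_refl. Qed.
Lemma gp_eq_sym p q : p ~~ q -> q ~~ p. Proof. exact: cg_sym. Qed.
Lemma gp_eq_trans q p r : p ~~ q -> q ~~ r -> p ~~ r. Proof. exact: cg_trans. Qed.
Lemma gp_eq_catl x p q : p ~~ q -> x ++ p ~~ x ++ q.
Proof. by move=> E; rewrite E. Qed.
Lemma gp_eq_catr x p q : p ~~ q -> p ++ x ~~ q ++ x.
Proof. by move=> E; rewrite E. Qed.

Lemma gp_catV p : p ++ winv p ~~ [::].
Proof.
elim: p => // a p IHp; rewrite winv_cons /= -(cat1s a) (catA p) IHp.
exact: cg_rel (gp_free w a).
Qed.

Lemma gp_Vcat p : winv p ++ p ~~ [::].
Proof. by rewrite -{2}[p]winvK; apply: gp_catV. Qed.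

Lemma gp_catKV p x : p ++ winv p ++ x ~~ x.
Proof. by rewrite catA gp_catV. Qed.

Lemma gp_catVK p x : winv p ++ p ++ x ~~ x.
Proof. by rewrite catA gp_Vcat. Qed.

Lemma gp_cat_eq p x y : p ++ x ~~ y -> x ~~ winv p ++ y.
Proof. by move=> <-; rewrite gp_catVK. Qed.

Lemma gp_cat_eqr p x y : x ++ p ~~ y -> x ~~ y ++ winv p.
Proof. by move=> <-; rewrite -catA gp_catV cats0. Qed.

Lemma gp_catI p x y : p ++ x ~~ p ++ y -> x ~~ y.
Proof. by move/gp_cat_eq; rewrite gp_catVK. Qed.

Lemma gp_Icat p x y : x ++ p ~~ y ++ p -> x ~~ y.
Proof. by move/gp_cat_eqr; rewrite -catA gp_catV cats0. Qed.

Global Instance gp_eq_winv : Proper (gp_eq w ==> gp_eq w) (@winv Z).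
Proof.
move=> p q E; apply: (@gp_catI q); apply: gp_eq_trans (gp_eq_sym (gp_catV q)).
exact: gp_eq_trans (gp_eq_catr _ (gp_eq_sym E)) (gp_catV p).
Qed.

Lemma gp_Vcat1 p q : winv p ++ q ~~ [::] <-> p ~~ q.
Proof.
split=> [E|->]; last exact: gp_Vcat.
by rewrite -[p]cats0 -E gp_catKV.
Qed.

(** A right action of letters in which inverse letters undo each other and the relator acts
    trivially factors through the group. Free reduction and the amalgamated normal form both get
    their uniqueness from it. *)
Lemma gp_eq_foldl T (Inv : T -> Prop) (act : T -> letter Z -> T) :
  (forall t a, Inv t -> Inv (act t a)) ->
  (forall t a, Inv t -> act (act t a) (linv a) = t) ->
  (forall t, Inv t -> foldl act t w = t) ->
  forall p q, p ~~ q -> forall t, Inv t -> foldl act t p = foldl act t q.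
Proof.
move=> InvA actV actw p q E.
have InvF t r : Inv t -> Inv (foldl act t r) by elim: r t => //= a r IHr t /(InvA _ a)/IHr.
elim: E => {p q} [p q [a|]|p|p q _ IH|p q r _ IH1 _ IH2|p p' q q' _ IH1 _ IH2] t tI //.
- exact: actV.
- exact: actw.
- by rewrite IH.
- by rewrite IH1 ?IH2.
- by rewrite !foldl_cat IH1 // IH2 //; apply: InvF.
Qed.
End PresentedGroup.

Lemma free_gp_eq Z (w p q : word Z) : gp_eq [::] p q -> gp_eq w p q.
Proof.
elim=> {p q} [p q [a|]|p|p q _ IH|p q r _ IH1 _ IH2|p p' q q' _ IH1 _ IH2].
- by apply: cg_rel; apply: gp_free.
- exact: cg_refl.
- exact: cg_refl.
- exact: cg_sym.
- exact: cg_trans IH2.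
- exact: cg_cat.
Qed.

(** * Free reduction *)

Notation feq := (gp_eq [::]).

Section FreeReduction.
Variable Z : eqType.
Implicit Types (p q s t x y : word Z) (a b : letter Z).

(* A stack is a reduced word read backwards. *)
Definition push s a : word Z :=
  if s is b :: s' then if b == linv a then s' else a :: s else [:: a].

Definition nf p : word Z := rev (foldl push [::] p).

Lemma eq_linv a b : (a == linv b) = (b == linv a).
Proof. by apply/eqP/eqP => ->; rewrite linvK. Qed.

Lemma reduced_rev p : reduced (rev p) = reduced p.
Proof.
rewrite /reduced rev_sorted; apply: eq_sorted => a b.
by congr negb; apply: eq_linv.
Qed.

Lemma reduced_push s a : reduced s -> reduced (push s a).
Proof.
case: s => //= b s; case: eqP => [_|/eqP ba] bs; first exact: path_sorted bs.
by rewrite /reduced /= ba.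
Qed.

Lemma push_linv s a : reduced s -> push (push s a) (linv a) = s.
Proof.
case: s => [_|b s] /=; first by rewrite linvK eqxx.
case: (b =P linv a) => [->|/eqP ba] /=; last by rewrite linvK eqxx.
by case: s => [|c s] //= /andP[/negPf ->].
Qed.

Lemma reduced_stack s p : reduced s -> reduced (foldl push s p).
Proof. by elim: p s => //= a p IHp s /(@reduced_push s a)/IHp. Qed.

Lemma reduced_nf p : reduced (nf p).
Proof. by rewrite /nf reduced_rev; apply: reduced_stack. Qed.

Lemma feq_stack p q : feq p q -> foldl push [::] p = foldl push [::] q.
Proof.
move=> E; apply: (gp_eq_foldl (Inv := fun s => reduced s) (act := push) _ _ _ E) => // s a.
  exact: reduced_push.
exact: push_linv.
Qed.

Lemma feq_nf p q : feq p q -> nf p = nf q.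
Proof. by move/feq_stack; rewrite /nf => ->. Qed.

Lemma nf_feq p : feq (nf p) p.
Proof.
suff E s : feq (rev (foldl push s p)) (rev s ++ p) by apply: E.
elim: p s => [|a p IHp] s /=; first by rewrite cats0.
rewrite IHp; case: s => [|b s] //=.
case: (b =P linv a) => [->|_]; last by rewrite !rev_cons -!cats1 -!catA.
rewrite rev_cons -cats1 -catA; apply: gp_eq_catl.
rewrite -cat1s -[a :: p]cat1s catA -[X in feq X]cat0s; apply: gp_eq_catr; symmetry.
by have := gp_Vcat [::] [:: a].
Qed.

Lemma nf_reduced p : reduced p -> nf p = p.
Proof.
move=> rp; rewrite /nf; suff -> : foldl push [::] p = rev p by exact: revK.
rewrite /rev.
have {rp} : reduced (rev [::] ++ p) by [].
elim: p [::] => //= a p IHp s rs.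
have -> : push s a = a :: s; last by apply: IHp; rewrite rev_cons cat_rcons.
case: s rs => // b s; rewrite rev_cons cat_rcons => /cat_sorted2[_] /= /andP[/negPf + _].
by rewrite eq_linv => ->.
Qed.

Lemma reduced_feq p q : reduced p -> reduced q -> feq p q -> p = q.
Proof. by move=> rp rq /feq_nf; rewrite !nf_reduced. Qed.

Lemma all_nf (P : pred (letter Z)) p : all P p -> all P (nf p).
Proof.
rewrite /nf all_rev; have: all P [::] by [].
elim: p [::] => //= a p IHp s sP /andP[aP pP]; apply: IHp => //.
case: s sP => [|b s] /=; first by rewrite aP.
by case: ifP => /= _ /andP[bP sP]; rewrite ?aP ?bP.
Qed.

(** In the Cayley tree, a path from 1 to [x y] must cross the vertex [x] of the geodesic. *)
Lemma feq_cat_split t x y : feq t (x ++ y) -> reduced (x ++ y) ->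
  exists t1 t2, [/\ t = t1 ++ t2, feq t1 x & feq t2 y].
Proof.
move=> E rxy; have {rxy E} : foldl push [::] t = rev (x ++ y).
  by rewrite (feq_stack E) -{2}(nf_reduced rxy) /nf revK.
elim/last_ind: t x y => [|t a IHt] x y E.
  by case: x y E => [|? ?] [|? ?] /(congr1 size) //=; [exists [::], [::] | rewrite size_rev..].
case/lastP: y E => [|y b] E.
  exists (rcons t a), [::]; rewrite cats0; split=> //.
  by rewrite -(nf_feq (rcons t a)) /nf E revK cats0.
move: E; rewrite foldl_rcons -rcons_cat rev_rcons => E.
(* The last letter of [t] either was pushed, and is then [b], or cancelled its inverse on top of the
   stack. *)
have [[ab Et]|Et] : (a = b /\ foldl push [::] t = rev (x ++ y)) \/
    foldl push [::] t = rev (x ++ rcons (rcons y b) (linv a)).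
  rewrite -!rcons_cat !rev_rcons -E; case: (foldl push [::] t) E => [|c s] /=.
    by case=> -> <-; left.
  by case: eqP => [-> _|_ [-> <-]]; [right | left].
- have [t1 [t2 [-> E1 E2]]] := IHt _ _ Et; exists t1, (rcons t2 a).
  by rewrite -rcons_cat ab -!cats1; split=> //; rewrite E2.
- have [t1 [t2 [-> E1 E2]]] := IHt _ _ Et; exists t1, (rcons t2 a).
  rewrite -rcons_cat; split=> //; rewrite -cats1 E2 -!cats1 -!catA.
  have -> : [:: linv a] ++ [:: a] = winv [:: a] ++ [:: a] by [].
  by rewrite gp_Vcat cats0.
Qed.
End FreeReduction.

(** * Powers *)

Section Powers.
Variable Z : eqType.
Implicit Types (c p : word Z).

Definition npow c n : word Z := iter n (cat c) [::].

Definition pw c (k : int) : word Z :=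
  match k with Posz n => npow c n | Negz n => winv (npow c n.+1) end.

Lemma npowSr c n : npow c n.+1 = npow c n ++ c.
Proof. by elim: n => [|n IHn] /=; rewrite ?cats0 // -catA -IHn. Qed.

Lemma pw1 c : pw c 1 = c. Proof. exact: cats0. Qed.

Lemma pwN c k : pw c (- k)%R = winv (pw c k).
Proof. by case: k => [[|n]|n] //=; rewrite winvK. Qed.

Lemma pwSr w c k : gp_eq w (pw c (k + 1)%R) (pw c k ++ c).
Proof.
case: k => n; first by rewrite (_ : (Posz n + 1)%R = Posz n.+1) /= -?npowSr //; lia.
rewrite (_ : (Negz n + 1)%R = (- Posz n)%R) ?pwN /=; last by lia.
by rewrite winv_cat -catA gp_Vcat cats0.
Qed.

Lemma pwD w c k l : gp_eq w (pw c (k + l)%R) (pw c k ++ pw c l).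
Proof.
have pwDn m n : gp_eq w (pw c (m + Posz n)%R) (pw c m ++ pw c n).
  elim: n => [|n IHn]; first by rewrite cats0 (_ : (m + 0)%R = m) //; lia.
  rewrite (_ : (m + Posz n.+1)%R = (m + Posz n + 1)%R); last by lia.
  by rewrite pwSr IHn (_ : Posz n.+1 = (Posz n + 1)%R) ?pwSr -?catA //; lia.
case: l => n //; have := pwDn (k + Negz n)%R n.+1.
rewrite (_ : (k + Negz n + n.+1)%R = k); last by lia.
by move=> ->; rewrite -catA gp_catV cats0.
Qed.

Lemma all_pw (P : pred (letter Z)) c k :
  (forall a, P (linv a) = P a) -> all P c -> all P (pw c k).
Proof.
move=> PV cP; have nP n : all P (npow c n) by elim: n => //= n IHn; rewrite all_cat cP.
case: k => n; first exact: nP.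
by rewrite /pw /winv all_rev all_map (eq_all PV); apply: nP.
Qed.

Lemma npow_conj w x c n :
  gp_eq w (npow (x ++ c ++ winv x) n) (x ++ npow c n ++ winv x).
Proof.
elim: n => [|n IHn] /=; first by rewrite gp_catV.
by rewrite -/(npow _ _) IHn -!catA gp_catVK.
Qed.

(** Free groups are torsion-free. If the first and last letters do not cancel, the powers of [c] are
    reduced; otherwise [c] is conjugate to a shorter reduced word. *)
Lemma npow_eq1 c n : reduced c -> c <> [::] -> feq (npow c n) [::] -> n = 0.
Proof.
move: {2}(size c) (leqnn (size c)) => m; elim: m c => [|m IHm] [|a c] //= le_c rc _ E.
have rpow : last a c != linv a \/ c = [::] -> n = 0.
  move=> cyc; have e_ac : a != linv (last a c).
    case: cyc => [|->]; first by rewrite eq_linv.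
    by case: (a) => z []; apply/eqP; case.
  have rn k : path (fun a b : letter Z => b != linv a) (last a c) (npow (a :: c) k).
    by elim: k => //= k IHk; rewrite e_ac cat_path IHk andbT.
  by case: (n) E => // k /reduced_feq; rewrite /reduced /= => /(_ _ isT); rewrite cat_path rn andbT => /(_ rc).
case/lastP: c le_c rc E rpow => [|c b] le_c rc E rpow; first by apply: rpow; right.
rewrite last_rcons in rpow; case: (b =P linv a) => [Eb|/eqP nb]; last by apply: rpow; left.
move: rc E; rewrite Eb -cats1 => rc E.
apply: (IHm c); first by move: le_c; rewrite size_rcons; lia.
- by move: rc => /= /path_sorted /cat_sorted2[].
- by move=> c0; move: rc; rewrite c0 /reduced /= eqxx.
have /gp_cat_eq := gp_eq_trans (gp_eq_sym (npow_conj [::] [:: a] c n)) E.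
by rewrite cats0 => /(gp_Icat (y := [::])).
Qed.

Lemma pw_inj c k l : reduced c -> c <> [::] -> feq (pw c k) (pw c l) -> k = l.
Proof.
move=> rc c0 E; have {E} : feq (pw c (k - l)%R) [::].
  by rewrite pwD pwN E gp_catV.
move Em: (k - l)%R => m; case: m Em => n Em /=; first by move/(npow_eq1 rc c0); lia.
rewrite -[[::]]/(winv (@nil (letter Z))) => /gp_eq_winv; rewrite winvK /=.
by move/(@npow_eq1 c n.+1 rc c0).
Qed.
End Powers.

(** * Normal forms in the amalgamated product *)

Section Amalgam.
Variables (Z : choiceType) (side : Z -> bool) (c : bool -> word Z).

Definition on (b : bool) (p : word Z) := all (fun a : letter Z => side a.1 == b) p.

Hypothesis c_reduced : forall b, reduced (c b).
Hypothesis c_neq0 : forall b, c b <> [::].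
Hypothesis c_on : forall b, on b (c b).

Let w := c false ++ winv (c true).
Local Notation geq := (gp_eq w).

Definition in_amalgam b m := exists k, feq m (pw (c b) k).

Lemma on_cat b p q : on b (p ++ q) = on b p && on b q.
Proof. exact: all_cat. Qed.

Lemma on_cons b a p : on b (a :: p) = (side a.1 == b) && on b p.
Proof. by []. Qed.

Lemma on_pw b k : on b (pw (c b) k).
Proof. by apply: all_pw => //; apply: c_on. Qed.

Lemma geq_pw b b' k : geq (pw (c b) k) (pw (c b') k).
Proof.
have cE : geq (c false) (c true).
  apply: (@gp_Icat _ _ (winv (c true))); rewrite (gp_catV w (c true)).
  exact: cg_rel (gp_relator _).
have nE n : geq (npow (c b) n) (npow (c b') n).
  elim: n => //= n IHn; rewrite IHn; apply: gp_eq_catr.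
  by case: (b) (b') => [] [] //; symmetry.
by case: k => n; rewrite /pw ?nE.
Qed.

(* Canonical representative of the coset [p <c b>]; that of the trivial coset
   is the empty word. *)
Definition coset_rep b p : word Z :=
  if `[< in_amalgam b p >] then [::]
  else choose (fun q => `[< on b q /\ exists k, feq q (p ++ pw (c b) k) >]) p.

Lemma coset_repP b p : on b p ->
  on b (coset_rep b p) /\ exists k, feq p (coset_rep b p ++ pw (c b) k).
Proof.
move=> pb; rewrite /coset_rep; case: asboolP => // pA.
set P := fun q => `[< _ >]; have /asboolP[? [k E]] : P (choose P p).
  by apply: chooseP; apply/asboolP; split=> //; exists 0; rewrite cats0.
by split=> //; exists (- k)%R; rewrite pwN; apply: gp_cat_eqr; symmetry; exact: E.
Qed.

Lemma coset_rep_eq b p q k : on b p -> on b q -> feq q (p ++ pw (c b) k) ->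
  coset_rep b q = coset_rep b p.
Proof.
move=> pb qb E; have pE : feq p (q ++ pw (c b) (- k)%R) by rewrite E pwN -catA gp_catV cats0.
have ext l q' : feq q' (q ++ pw (c b) l) -> feq q' (p ++ pw (c b) (k + l)%R).
  by move=> ->; rewrite E -catA pwD.
have ext' l q' : feq q' (p ++ pw (c b) l) -> feq q' (q ++ pw (c b) (- k + l)%R).
  by move=> ->; rewrite {1}pE -catA pwD.
have A_E : in_amalgam b q <-> in_amalgam b p.
  rewrite /in_amalgam; split=> -[l lE].
    by exists (l + - k)%R; rewrite pE lE pwD.
  by exists (l + k)%R; rewrite E lE pwD.
rewrite /coset_rep (asbool_equiv_eq A_E); case: asboolP => // _.
set P := fun q' => _; set P' := fun q' => _.
have PP' : P =1 P'.
  move=> q'; apply: asbool_equiv_eq.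
  by split=> -[q'b [l lE]]; split=> //; eexists; [apply: ext | apply: ext']; apply: lE.
rewrite (eq_choose PP'); apply: choose_id; apply/asboolP; split=> //; first by exists k.
by exists 0; rewrite cats0.
Qed.

Lemma coset_rep_nil b p : on b p -> coset_rep b p = [::] <-> in_amalgam b p.
Proof.
move=> pb; split=> [E|]; last by rewrite /coset_rep; case: asboolP.
by have [_ [k]] := coset_repP pb; rewrite E; exists k.
Qed.

Definition coset_exp b p : int :=
  if pselect (exists k, feq p (coset_rep b p ++ pw (c b) k)) is left e then projT1 (cid e) else 0.

Lemma coset_expP b p : on b p -> feq p (coset_rep b p ++ pw (c b) (coset_exp b p)).
Proof.
case/coset_repP => _ e; rewrite /coset_exp; case: pselect => // e'.
by case: cid.
Qed.

Lemma coset_exp_eq b p k : on b p -> feq p (coset_rep b p ++ pw (c b) k) -> coset_exp b p = k.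
Proof.
move=> /coset_expP E; rewrite {1}E => /gp_catI.
exact: pw_inj.
Qed.

(* The normal form [t_1 ... t_n c^k] is kept as the stack [t_n, ..., t_1] of its
   coset representatives, each tagged with its side, and the exponent [k]. *)
Definition state := (seq (bool * word Z) * int)%type.
Implicit Types (s : state) (l : seq (bool * word Z)).

Definition top b l := if l is (b', _) :: _ then b' == b else false.

Fixpoint normal l : Prop :=
  if l is (b, t) :: l' then
    [/\ on b t, coset_rep b t = t, t <> [::], ~~ top b l' & normal l']
  else True.

(** Reads the end of a normal form as an element of the factor [b], absorbing the top syllable when
    it lies there. [split] is the inverse operation, up to free equality. *)
Definition merge b s : seq (bool * word Z) * word Z :=
  if s.1 is (b', t) :: l' then
    if b' == b then (l', t ++ pw (c b) s.2) else (s.1, pw (c b) s.2)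
  else ([::], pw (c b) s.2).

Definition split b l p : state :=
  (if coset_rep b p is [::] then l else (b, coset_rep b p) :: l, coset_exp b p).

(** Van der Waerden's method: letters act on normal forms by right multiplication, which avoids any
    confluence argument. *)
Definition act s (a : letter Z) : state :=
  let b := side a.1 in split b (merge b s).1 ((merge b s).2 ++ [:: a]).

Lemma merge_normal b s : normal s.1 ->
  [/\ normal (merge b s).1, ~~ top b (merge b s).1 & on b (merge b s).2].
Proof.
case: s => -[|[b' t] l] k; rewrite /merge /=; first by rewrite on_pw.
by case: (b' =P b) => [->|/eqP/negPf nb] [] /=; rewrite ?nb ?on_cat on_pw => ->.
Qed.

Lemma split_normal b l p : normal l -> ~~ top b l -> on b p -> normal (split b l p).1.
Proof.
move=> nl ntop pb; have [rb [k E]] := coset_repP pb.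
rewrite /split; case Er: (coset_rep b p) => [|a t] //; rewrite -Er; split=> //.
  by symmetry; apply: (coset_rep_eq rb pb E).
by rewrite Er.
Qed.

Lemma split_merge b s : normal s.1 -> split b (merge b s).1 (merge b s).2 = s.
Proof.
case: s => l k; rewrite /merge /=.
have pw_case : split b l (pw (c b) k) = (l, k).
  have E : coset_rep b (pw (c b) k) = [::].
    by apply/coset_rep_nil; [exact: on_pw | exists k].
  by rewrite /split E; congr pair; apply: coset_exp_eq; rewrite ?on_pw ?E.
case: l pw_case => //= -[b' t] l pw_case; case: (b' =P b) => [-> {pw_case}|//] [tb rt t0 _ _].
have E : coset_rep b (t ++ pw (c b) k) = t.
  by rewrite -{2}rt; apply: (@coset_rep_eq _ _ _ k); rewrite ?on_cat ?tb ?on_pw.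
have -> : split b l (t ++ pw (c b) k) = ((b, t) :: l, coset_exp b (t ++ pw (c b) k)).
  by rewrite /split E; case: (t) t0.
by congr pair; apply: coset_exp_eq; rewrite ?E ?on_cat ?tb ?on_pw.
Qed.

Lemma merge_split b l p : ~~ top b l -> on b p ->
  (merge b (split b l p)).1 = l /\ feq (merge b (split b l p)).2 p.
Proof.
move=> ntop pb; have := coset_expP pb; rewrite /split /merge.
case E: (coset_rep b p) => [|a t] /= pE; last by rewrite eqxx /=; split=> //; symmetry.
by case: l ntop => [|[b' t] l] /= => [_|/negPf ->]; split=> //=; symmetry.
Qed.

Lemma split_feq b l p q : on b p -> on b q -> feq p q -> split b l p = split b l q.
Proof.
move=> pb qb E; have Er : coset_rep b p = coset_rep b q.
  by apply: (@coset_rep_eq _ _ _ 0); rewrite ?cats0.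
rewrite /split Er; congr pair; apply: coset_exp_eq => //.
by rewrite Er E; apply: coset_expP.
Qed.

Lemma act_normal s a : normal s.1 -> normal (act s a).1.
Proof.
move=> ns; rewrite /act; set b := side _; have [nl ntop pb] := merge_normal b ns.
by apply: split_normal => //; rewrite on_cat pb /= eqxx.
Qed.

Lemma foldl_act_normal s p : normal s.1 -> normal (foldl act s p).1.
Proof. by elim: p s => //= a p IHp s /(@act_normal _ a)/IHp. Qed.

(** A word on one side acts in a single operation, by multiplication in its free factor; freely
    equal words of one side thus act alike. *)
Lemma foldl_act b s q : normal s.1 -> on b q ->
  foldl act s q = split b (merge b s).1 ((merge b s).2 ++ q).
Proof.
elim: q s => [|a q IHq] s ns; first by rewrite cats0 split_merge.
rewrite on_cons => /andP[/eqP ab qb].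
rewrite /= (IHq _ (act_normal a ns) qb) /act ab.
have [nl ntop pb] := merge_normal b ns.
have pab : on b ((merge b s).2 ++ [:: a]) by rewrite on_cat pb /= ab eqxx.
have [-> E] := merge_split ntop pab.
apply: split_feq; rewrite ?on_cat ?pb ?qb ?on_cons ?ab ?eqxx ?andbT //.
  by have [] := merge_normal b (split_normal nl ntop pab).
by rewrite E -catA.
Qed.

(** The result does not depend on [b]: this is where the amalgamation enters the action. *)
Lemma foldl_act_c b s : normal s.1 -> foldl act s (c b) = (s.1, s.2 + 1)%R.
Proof.
move=> ns; rewrite (foldl_act ns (c_on b)).
rewrite -[RHS](@split_merge b) //; have [_ _ pb] := merge_normal b ns.
have [_ _ qb] := @merge_normal b (s.1, s.2 + 1)%R ns.
have -> : (merge b (s.1, s.2 + 1)%R).1 = (merge b s).1.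
  by rewrite /merge /=; case: (s.1) => [|[b' t] l] //=; case: eqP.
apply: split_feq; rewrite ?on_cat ?pb ?c_on //; rewrite /merge /=.
by case: (s.1) => [|[b' t] l] /=; [|case: eqP => _ /=]; rewrite pwSr ?catA.
Qed.

Lemma act_geq s p q : normal s.1 -> geq p q -> foldl act s p = foldl act s q.
Proof.
have actV s' a : normal s'.1 -> act (act s' a) (linv a) = s'.
  move=> ns; set b := side a.1; have a_b : on b [:: a; linv a] by rewrite /= eqxx.
  rewrite -[LHS]/(foldl act s' [:: a; linv a]) (foldl_act ns a_b) -[RHS](@split_merge b) //.
  have [_ _ pb] := merge_normal b ns; apply: split_feq; rewrite ?on_cat ?pb //.
  by have := gp_catV [::] [:: a]; rewrite /= => ->; rewrite cats0.
move=> ns E; apply: (gp_eq_foldl (Inv := fun s => normal s.1) _ actV _ E) => // [s' a|s' ns'].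
  exact: act_normal.
(* As [c false] and [c true] act alike, the relator acts as [c true ++ winv (c true)], a word on one
   side. *)
rewrite foldl_cat foldl_act_c // -(foldl_act_c true) // -foldl_cat.
have ccV : on true (c true ++ winv (c true)).
  by rewrite on_cat c_on -[c true]pw1 -pwN on_pw.
rewrite (foldl_act ns' ccV) -[RHS](@split_merge true) //.
have [_ _ pb] := merge_normal true ns'; apply: split_feq; rewrite ?on_cat ?pb -?on_cat //.
by rewrite gp_catV cats0.
Qed.

Definition eval_stack l : word Z := flatten [seq t.2 | t <- rev l].
Definition eval s : word Z := eval_stack s.1 ++ pw (c false) s.2.

Lemma eval_cons bt l : eval_stack (bt :: l) = eval_stack l ++ bt.2.
Proof. by rewrite /eval_stack rev_cons map_rcons -cats1 flatten_cat /= cats0. Qed.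

Lemma eval_merge b s : geq (eval s) (eval_stack (merge b s).1 ++ (merge b s).2).
Proof.
case: s => -[|[b' t] l] k; rewrite /merge /eval /=; first exact: geq_pw.
by case: eqP => _ /=; rewrite ?eval_cons -?catA /= (geq_pw _ b).
Qed.

Lemma eval_split b l p : on b p -> geq (eval (split b l p)) (eval_stack l ++ p).
Proof.
move/coset_expP/(free_gp_eq w); rewrite /split /eval /= (geq_pw _ b).
by case: (coset_rep b p) (coset_exp b p) => [|a t] k ->; rewrite ?eval_cons -?catA.
Qed.

Definition nform p : state := foldl act ([::], 0%R) p.

Lemma eval_nform p : geq (eval (nform p)) p.
Proof.
suff E s : normal s.1 -> geq (eval (foldl act s p)) (eval s ++ p) by apply: E.
elim: p s => [|a p IHp] s ns; first by rewrite cats0.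
apply: gp_eq_trans (IHp _ (act_normal a ns)) _.
rewrite -[a :: p]/([:: a] ++ p) catA; apply: gp_eq_catr; rewrite /act.
have [_ _ pb] := merge_normal (side a.1) ns; rewrite eval_split ?on_cat ?pb /= ?eqxx //.
by rewrite (eval_merge (side a.1) s) catA.
Qed.

Lemma geq_nform p q : geq p q <-> nform p = nform q.
Proof.
split=> [|E]; first exact: act_geq.
by rewrite -(eval_nform p) E eval_nform.
Qed.

Lemma nform_on b m : on b m -> nform m = split b [::] m.
Proof. by move=> mb; rewrite /nform (foldl_act _ mb). Qed.

(** The exponent [k] passes into the new syllable, which stays outside the amalgamated subgroup; the
    stack of [h] is left untouched. *)
Lemma nform_cat b h m t l k : nform h = ((~~ b, t) :: l, k) -> on b m -> ~ in_amalgam b m ->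
  nform (h ++ m) = ((b, coset_rep b (pw (c b) k ++ m)) :: (~~ b, t) :: l,
                    coset_exp b (pw (c b) k ++ m)).
Proof.
move=> E mb mA; have nh : normal (nform h).1 by apply: foldl_act_normal.
rewrite /nform foldl_cat -/(nform h) (foldl_act nh mb) E /merge /= (negPf (_ : ~~ b != b)) /=; last by case: (b).
have pb : on b (pw (c b) k ++ m) by rewrite on_cat on_pw.
rewrite /split; case Er: (coset_rep b _) => [|//]; case: mA.
have /(coset_rep_nil pb)[j jE] := Er; exists (- k + j)%R.
by rewrite pwD -jE pwN gp_catVK.
Qed.

(** * Alternating products *)

Section Alternating.
Variables (M : bool -> word Z -> Prop) (R : word Z -> word Z -> Prop).

(* [R] is abstract because it stands both for equality in the group and for the
   natural order of the inverse monoid. *)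
Inductive alternating : bool -> word Z -> Prop :=
| alt_one b m x : M b m -> ~ in_amalgam b m -> R x m -> alternating b x
| alt_cat b h m x : alternating (~~ b) h -> M b m -> ~ in_amalgam b m ->
    R x (h ++ m) -> alternating b x.

Lemma alternating_inv b x : alternating b x ->
  (exists m, [/\ M b m, ~ in_amalgam b m & R x m]) \/
  exists h m, [/\ alternating (~~ b) h, M b m, ~ in_amalgam b m & R x (h ++ m)].
Proof. by case=> {b x} [b m x Mm mA xm|b h m x hA Mm mA xm]; [left; exists m | right; exists h, m]. Qed.

Hypothesis M_cat : forall b m m', M b m -> M b m' -> M b (m ++ m').
Hypothesis M_nil : forall b, M b [::].
Hypothesis M_pw : forall b b' m k, M b m -> feq m (pw (c b) k) -> M b' (pw (c b') k).
Hypothesis R_refl : forall p, R p p.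
Hypothesis R_trans : forall p q r, R p q -> R q r -> R p r.
Hypothesis R_cat : forall p p' q q', R p p' -> R q q' -> R (p ++ q) (p' ++ q').
Hypothesis R_pw : forall b b' m k, M b m -> feq m (pw (c b) k) -> R m (pw (c b') k).

Definition power_or_alternating x :=
  (exists2 k, M false (pw (c false) k) & R x (pw (c false) k)) \/ exists b, alternating b x.

Lemma in_amalgam_cat_pw b m k : in_amalgam b (m ++ pw (c b) k) -> in_amalgam b m.
Proof. by case=> j /gp_cat_eqr E; exists (j - k)%R; rewrite pwD pwN. Qed.

Lemma alternating_pw b x k y : alternating b x -> M b (pw (c b) k) ->
  R y (x ++ pw (c b) k) -> alternating b y.
Proof.
case=> {b x} [b m x Mm mA Rx|b h m x hA Mm mA Rx] Mk Ry.
  apply: (@alt_one _ (m ++ pw (c b) k)); first exact: M_cat.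
    by move/in_amalgam_cat_pw.
  by apply: R_trans Ry _; apply: R_cat.
apply: (alt_cat (m := m ++ pw (c b) k) hA); first exact: M_cat.
  by move/in_amalgam_cat_pw.
by rewrite catA; apply: R_trans Ry _; apply: R_cat.
Qed.

(** A factor on the side of the last syllable merges with it. If the result falls into the
    amalgamated subgroup, [M_pw] moves it to the other side, where the previous syllable absorbs
    it. *)
Lemma power_or_alternating_cat b x m :
  power_or_alternating x -> M b m -> power_or_alternating (x ++ m).
Proof.
case=> [[k Mk Rx]|[b' xb'] Mm].
  move=> Mm; have Mk' : M b (pw (c b) k) by apply: (@M_pw false b (pw (c false) k) k Mk).
  have Rxm : R (x ++ m) (pw (c b) k ++ m).
    by apply: R_cat => //; apply: R_trans Rx _; apply: (@R_pw false b (pw (c false) k) k Mk).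
  have MM := M_cat Mk' Mm.
  case: (pselect (in_amalgam b (pw (c b) k ++ m))) => [[j jE]|nA].
    left; exists j; first exact: (@M_pw _ _ _ _ MM jE).
    by apply: R_trans Rxm _; apply: (@R_pw _ _ _ _ MM jE).
  by right; exists b; apply: (alt_one MM nA Rxm).
case: (b' =P b) => [E|/eqP nb]; last first.
  have {nb}E : b' = ~~ b by case: (b) (b') nb => [] [].
  case: (pselect (in_amalgam b m)) => [[j jE]|nA]; right; last first.
    by exists b; apply: (alt_cat (h := x) (m := m)); rewrite -?E.
  exists b'; apply: (alternating_pw xb' (@M_pw _ _ _ _ Mm jE)).
  by apply: R_cat => //; apply: (@R_pw _ _ _ _ Mm jE).
move: E xb' => -> xb; case: xb Mm => {b' b x} [b m1 x Mm1 m1A Rx|b h m1 x hA Mm1 m1A Rx] Mm.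
  have MM := M_cat Mm1 Mm; have Rxm : R (x ++ m) (m1 ++ m) by apply: R_cat.
  case: (pselect (in_amalgam b (m1 ++ m))) => [[j jE]|nA].
    left; exists j; first exact: (@M_pw _ _ _ _ MM jE).
    by apply: R_trans Rxm _; apply: (@R_pw _ _ _ _ MM jE).
  by right; exists b; apply: (alt_one MM nA Rxm).
have MM := M_cat Mm1 Mm; have Rxm : R (x ++ m) (h ++ m1 ++ m) by rewrite catA; apply: R_cat.
case: (pselect (in_amalgam b (m1 ++ m))) => [[j jE]|nA]; right; last first.
  by exists b; apply: (alt_cat hA MM nA Rxm).
exists (~~ b); apply: (alternating_pw hA (@M_pw _ _ _ _ MM jE)).
by apply: R_trans Rxm _; apply: R_cat => //; apply: (@R_pw _ _ _ _ MM jE).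
Qed.

Lemma power_or_alternating_flatten (s : seq (word Z)) :
  (forall m, m \in s -> exists b, M b m) -> power_or_alternating (flatten s).
Proof.
elim/last_ind: s => [|s m IHs] sM; first by left; exists 0; [apply: (M_nil) | apply: R_refl].
have [b Mm] : exists b, M b m by apply: sM; rewrite mem_rcons mem_head.
rewrite -cats1 flatten_cat /= cats0; apply: power_or_alternating_cat Mm.
by apply: IHs => m' m's; apply: sM; rewrite mem_rcons inE m's orbT.
Qed.
End Alternating.

Lemma alternating_nform M R b x :
  (forall b m, M b m -> on b m) -> (forall p q, R p q -> geq p q) ->
  alternating M R b x -> exists t l k, nform x = ((b, t) :: l, k).
Proof.
move=> M_on R_geq; elim=> {b x} [b m x Mm mA /R_geq/geq_nform ->|b h m x _ IH Mm mA /R_geq/geq_nform ->].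
  have mb := M_on _ _ Mm; rewrite (nform_on mb) /split.
  by case E: coset_rep => [|a t]; [case: mA; apply/coset_rep_nil | do 3 eexists].
by have [t [l [k E]]] := IH; rewrite (nform_cat E (M_on _ _ Mm) mA); do 3 eexists.
Qed.
(** * Submonoids of the amalgamated product *)

Lemma power_or_alternating_word x : power_or_alternating on geq x.
Proof.
have -> : x = flatten [seq [:: a] | a <- x] by elim: x => //= a x {1}->.
apply: power_or_alternating_flatten => //.
- by move=> b m m'; rewrite on_cat => -> ->.
- by move=> b b' m k _ _; apply: on_pw.
- exact: cg_trans.
- by move=> p p' q q' -> ->.
- by move=> b b' m k _ /(free_gp_eq w) ->; apply: geq_pw.
by move=> m /mapP[a _ ->]; exists (side a.1); rewrite /= eqxx.
Qed.

(** The free factors embed: the normal form of a word on one side records its coset representative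
    and exponent, which determine it up to free equality. *)
Lemma geq_on b p q : on b p -> on b q -> geq p q -> feq p q.
Proof.
move=> pb qb /geq_nform; rewrite !(nform_on (b := b)) //.
move=> E; have := coset_expP pb; have := coset_expP qb.
move: E; rewrite /split; case: (coset_rep b p) (coset_rep b q) => [|a t] [|a' t'] //= [].
  by move=> -> <- <-.
by move=> <- <- <- <- <-.
Qed.

Lemma on_nf b p : on b p -> on b (nf p).
Proof. exact: all_nf. Qed.

Lemma nform_pw k : nform (pw (c false) k) = ([::], k).
Proof.
have pA : in_amalgam false (pw (c false) k) by exists k.
rewrite (nform_on (on_pw false k)) /split.
have E : coset_rep false (pw (c false) k) = [::].
  by apply/coset_rep_nil => //; apply: on_pw.
by rewrite E; congr pair; apply: coset_exp_eq; rewrite ?E // on_pw.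
Qed.

Section Submonoid.
Variable M : bool -> word Z -> Prop.
Hypothesis M_on : forall b m, M b m -> on b m.
Hypothesis M_feq : forall b m m', M b m -> on b m' -> feq m m' -> M b m'.
Hypothesis M_cat : forall b m m', M b m -> M b m' -> M b (m ++ m').
Hypothesis M_nil : forall b, M b [::].
Hypothesis M_c : forall b, M b (c b).
Hypothesis M_pw : forall b b' k, M b (pw (c b) k) -> M b' (pw (c b') k).

Definition generated x :=
  exists2 s : seq (word Z), (forall m, m \in s -> exists b, M b m) & geq x (flatten s).

Lemma generated_geq x y : geq x y -> generated y -> generated x.
Proof. by move=> E [s sM ys]; exists s => //; rewrite E. Qed.

Lemma generated_cat x y : generated x -> generated y -> generated (x ++ y).
Proof.
case=> s sM xs [t tM yt]; exists (s ++ t) => [m|].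
  by rewrite mem_cat => /orP[/sM|/tM].
by rewrite flatten_cat xs yt.
Qed.

Lemma M_generated b m : M b m -> generated m.
Proof.
by move=> Mm; exists [:: m] => [m'|]; [rewrite inE => /eqP->; exists b | rewrite /= cats0].
Qed.

Lemma generated_npow b n : generated (pw (c b) (Posz n)).
Proof.
elim: n => [|n IHn]; first by exists [::].
rewrite [pw _ _]/(c b ++ pw (c b) n).
exact: generated_cat (M_generated (M_c b)) IHn.
Qed.

Lemma M_npow b n : M b (pw (c b) (Posz n)).
Proof. by elim: n => [|n IHn]; [exact: M_nil | exact: M_cat (M_c b) IHn]. Qed.

Lemma generated_form x : generated x -> power_or_alternating M geq x.
Proof.
have M_pw' b b' m k : M b m -> feq m (pw (c b) k) -> M b' (pw (c b') k).
  by move=> Mm mk; apply: (@M_pw b); apply: M_feq mk => //; exact: on_pw.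
have geq_cat p p' q q' : geq p p' -> geq q q' -> geq (p ++ q) (p' ++ q') by move=> -> ->.
have geq_pw' b b' m k : M b m -> feq m (pw (c b) k) -> geq m (pw (c b') k).
  by move=> _ /(free_gp_eq w) ->; apply: geq_pw.
case=> s sM xs; have [[k Mk Rx]|[b alt]] := power_or_alternating_flatten M_cat M_nil M_pw'
  (@gp_eq_refl _ _) (@cg_trans _ _) geq_cat geq_pw' sM.
  by left; exists k => //; rewrite xs.
right; exists b; case: alt xs => {b}[b m y Mm mA ->|b h m y hA Mm mA ->] xs.
  exact: alt_one mA xs.
exact: alt_cat hA Mm mA xs.
Qed.

Lemma alternating_generated b x : alternating M geq b x -> generated x.
Proof.
elim=> {b x} [b m x Mm _ xm|b h m x _ IH Mm _ xm]; apply: generated_geq xm _.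
  exact: M_generated Mm.
exact: generated_cat IH (M_generated Mm).
Qed.

Lemma alternating_geqE M' b x : (forall b m, M' b m -> on b m) -> alternating M' geq b x ->
  exists t l k, nform x = ((b, t) :: l, k).
Proof. by move=> M'on; apply: alternating_nform. Qed.

(** The normal form of [g] has at most one syllable, so an alternating product equal to [g] has a
    single factor; the remaining case is a power of [c], moved to side [b] by [M_pw]. *)
Lemma generated_on b g : on b g -> generated g -> M b g.
Proof.
move=> gb /generated_form[[k Mk gk]|[b' alt]].
  have {}gk : geq (pw (c b) k) g by rewrite gk; apply: geq_pw.
  by apply: (M_feq (@M_pw _ b _ Mk)) => //; apply: (@geq_on b) gk => //; apply: on_pw.
have [t [l [k]]] := alternating_geqE M_on alt.
rewrite (nform_on gb) /split; case: coset_rep => // a t' [bb' _ El _].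
move: alt; rewrite -bb' => /alternating_inv[[m [Mm _ gm]]|[h [m [hA Mm mA gm]]]].
  by apply: (M_feq Mm gb); apply: (@geq_on b) => //; [apply: M_on | symmetry].
have [t1 [l' [k' E]]] := alternating_geqE M_on hA.
move/geq_nform: gm.
rewrite (nform_cat E (M_on Mm) mA).
rewrite (nform_on gb) /split.
by case: coset_rep.
Qed.

(** The product [h g] and an alternating product of elements of [M] equal to it have the same normal
    form, so their last factors differ only by a power of [c] moved across the cut. *)
Lemma generated_cat_on b h g : alternating on geq (~~ b) h -> on b g -> ~ in_amalgam b g ->
  generated (h ++ g) ->
  exists2 k, generated (h ++ pw (c (~~ b)) k) & M b (winv (pw (c b) k) ++ g).
Proof.
move=> hA gb gA /generated_form hg.
have [t [l [k Eh]]] := alternating_geqE (fun _ _ => id) hA.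
have Ehg := nform_cat Eh gb gA.
case: hg => [[j _ /geq_nform]|[b' alt]].
  by rewrite Ehg nform_pw.
case: (alternating_inv alt) => [[m [Mm mA /geq_nform]]|].
  by rewrite Ehg (nform_on (M_on Mm)) /split; case: (coset_rep b' m).
move=> [h' [m [h'A Mm mA /geq_nform]]].
have [t' [l' [k' Eh']]] := alternating_geqE M_on h'A.
rewrite Ehg (nform_cat Eh' (M_on Mm) mA) => -[Eb Er _ Et El Ek].
move: Eb Et El Er Ek h'A Eh' Mm mA => <- <- <- Er Ek h'A Eh' Mm mA.
have {Er Ek} gm : feq (pw (c b) k ++ g) (pw (c b) k' ++ m).
  have pb := on_pw b; have mb := M_on Mm.
  rewrite (coset_expP (b := b) (p := pw (c b) k ++ g)); last by rewrite on_cat pb.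
  by rewrite Er Ek -coset_expP // on_cat pb.
(* The left parts [h] and [h'] share their stack and have exponents [k] and [k']. *)
exists (k' - k)%R.
  apply: generated_geq (alternating_generated h'A).
  rewrite -(eval_nform h) -(eval_nform h') Eh Eh'.
  rewrite /eval -catA; apply: gp_eq_catl; rewrite (geq_pw (~~ b) false) -pwD.
  by rewrite (_ : (k + (k' - k) = k')%R) //; lia.
apply: (M_feq Mm); first by rewrite -pwN on_cat on_pw.
move/gp_eq_sym/gp_cat_eq: gm => ->; rewrite -!pwN catA; apply: gp_eq_catr.
by rewrite -pwD (_ : (- k' + k = - (k' - k))%R) //; lia.
Qed.

(** * Certificates of non-membership *)

Definition syllable b g := [/\ on b g, reduced g & ~ in_amalgam b g].

(* [g] lies outside [M b], or outside its saturation by powers of [c b] on the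
   left if [l], on the right if [r]. *)
Definition avoids (l r : bool) b g := forall i j : int, (l || (i == 0)) -> (r || (j == 0)) ->
  ~ M b (pw (c b) i ++ g ++ pw (c b) j).

(* [certificate None b x] only says that [x] is an alternating product ending on side
   [b]; [Some false] puts [x] outside the generated submonoid, and [Some true] all the
   [x c^k].  As the submonoid contains [c], the set of [k] with [h c^k] in it is closed
   upwards: it is everything ([certificate_left]), nothing ([certificate_all]), or has a
   least element, which is [1] after moving a power of [c] across ([certificate_step]). *)
Inductive certificate : option bool -> bool -> word Z -> Prop :=
| certificate_base b g : syllable b g -> certificate None b g
| certificate_avoid r b g : syllable b g -> avoids false r b g -> certificate (Some r) b g
| certificate_cat b h g : certificate None (~~ b) h -> syllable b g -> certificate None b (h ++ g)
| certificate_left r b h g : certificate None (~~ b) h -> syllable b g -> avoids true r b g ->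
    certificate (Some r) b (h ++ g)
| certificate_step r b h g : certificate (Some false) (~~ b) h -> syllable b g ->
    avoids false r b g -> certificate (Some r) b (h ++ c (~~ b) ++ g)
| certificate_all r b h g : certificate (Some true) (~~ b) h -> syllable b g ->
    certificate (Some r) b (h ++ g).

Lemma on_alternating_pw b x k : alternating on geq b x ->
  alternating on geq b (x ++ pw (c b) k).
Proof.
move=> xA; apply: alternating_pw xA _ _ => //.
- by move=> b' m m'; rewrite on_cat => -> ->.
- exact: cg_trans.
- by move=> p p' q q' -> ->.
- exact: on_pw.
Qed.

Lemma certificate_sound o b x : certificate o b x ->
  alternating on geq b x /\
  if o is Some r then forall k : int, r || (k == 0) -> ~ generated (x ++ pw (c b) k) else True.
Proof.
have on_catpw b' g k : on b' g -> on b' (g ++ pw (c b') k) by rewrite on_cat on_pw // => ->.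
have A_pw b' g k : ~ in_amalgam b' g -> ~ in_amalgam b' (g ++ pw (c b') k).
  by move=> gA /in_amalgam_cat_pw.
elim=> {o b x} [b g|r b g|b h g _ [hA _]|r b h g _ [hA _]|r b h g _ [hA hP]|r b h g _ [hA hP]] [gb rg gA].
- by split=> //; apply: alt_one gA _.
- move=> av; split=> [|k rk /generated_on Mg]; first exact: alt_one gA _.
  by apply: (av 0 k) => //; apply: Mg; apply: on_catpw.
- by split=> //; apply: alt_cat hA gb gA _.
- move=> av; split=> [|k rk]; first exact: alt_cat hA gb gA _.
  rewrite -catA => /(generated_cat_on hA (on_catpw _ _ _ gb) (A_pw _ _ _ gA))[j _].
  by rewrite -pwN; apply: av.
- move=> av; have hcA := on_alternating_pw 1 hA; rewrite pw1 in hcA.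
  rewrite catA; split=> [|k rk]; first exact: alt_cat hcA gb gA _.
  (* Here [h c c^j] is generated and [c^(-j) g c^k] is in [M b]. If [j] is non-negative, multiplying
     by [c^j] puts [g c^k] in [M b]; otherwise [1 + j] is at most 0, and multiplying by a
     non-negative power of [c] makes [h] itself generated. *)
  rewrite -catA => /(generated_cat_on hcA (on_catpw _ _ _ gb) (A_pw _ _ _ gA))[[j|j] Pj Mj].
    apply: (av 0 k) => //; apply: M_feq (M_cat (M_npow b j) Mj) _ _; first exact: on_catpw.
    by rewrite gp_catKV.
  apply: (hP 0) => //; rewrite cats0; apply: generated_geq (generated_cat Pj (generated_npow (~~ b) j)).
  rewrite -!catA -{1}[c (~~ b)]pw1 -!pwD (_ : (1 + (Negz j + j) = 0)%R) ?cats0 //; lia.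
- split=> [|k rk]; first exact: alt_cat hA gb gA _.
  rewrite -catA => /(generated_cat_on hA (on_catpw _ _ _ gb) (A_pw _ _ _ gA))[j Pj _].
  exact: hP Pj.
Qed.

Lemma upward_closed_threshold (S : int -> Prop) : (forall k, S k -> S (k + 1)%R) ->
  [\/ forall k, S k, forall k, ~ S k | exists k, ~ S k /\ S (k + 1)%R].
Proof.
move=> up; case: (pselect (exists k, ~ S k)) => [[i nSi]|all_S]; last first.
  by constructor 1 => k; apply: contrapT => nSk; apply: all_S; exists k.
case: (pselect (exists k, S k)) => [[j Sj]|no_S]; last first.
  by constructor 2 => k Sk; apply: no_S; exists k.
have upn k (n : nat) : S k -> S (k + n)%R.
  elim: n => [|n IHn] Sk; first by rewrite (_ : (k + 0)%R = k) //; lia.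
  by rewrite (_ : (k + n.+1)%R = (k + n + 1)%R); [apply/up/IHn | lia].
have {j Sj}[n Sn] : exists n : nat, S (i + n)%R.
  exists (absz (j - i)%R); have := upn j (absz (i + absz (j - i)%R - j)%R) Sj.
  by congr S; lia.
constructor 3; elim: n Sn => [|n IHn] Sn.
  by case: nSi; rewrite (_ : i = (i + 0)%R) //; lia.
case: (pselect (S (i + n)%R)) => [/IHn //|nSn]; exists (i + n)%R; split=> //.
by rewrite (_ : (i + n + 1)%R = (i + n.+1)%R) //; lia.
Qed.

(** The exponent [i] varies in the induction because the step rule needs a certificate of [h c^k],
    with [k] the threshold of [h]. *)
Lemma certificate_complete b x i : alternating on geq b x ->
  (exists2 y, geq (x ++ pw (c b) i) y & certificate None b y) /\
  forall r : bool, (forall k : int, r || (k == 0) -> ~ generated (x ++ pw (c b) i ++ pw (c b) k)) ->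
    exists2 y, geq (x ++ pw (c b) i) y & certificate (Some r) b y.
Proof.
have syl b' p m i' : on b' p -> on b' m -> in_amalgam b' p -> ~ in_amalgam b' m ->
    syllable b' (nf (p ++ m ++ pw (c b') i')).
  move=> pb mb [j pj] mA; split; first by rewrite on_nf // !on_cat pb mb on_pw.
    exact: reduced_nf.
  case=> k; rewrite nf_feq pj => /gp_cat_eq E; apply: mA; apply: (@in_amalgam_cat_pw _ _ i').
  by exists (- j + k)%R; rewrite E pwD pwN.
move=> xA; elim: xA i => {b x} [b m x mb mA xm|b h m x hA IH mb mA xm] i.
  have A0 : in_amalgam b [::] by exists 0%R.
  have sg := syl b [::] m i isT mb A0 mA.
  set g := nf _ in sg; have E : geq (x ++ pw (c b) i) g.
    by rewrite /g (free_gp_eq w (nf_feq _)) xm.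
  split=> [|r av]; exists g => //; first exact: certificate_base.
  apply: certificate_avoid => // i' k /= /eqP -> rk /M_generated Mg; apply: (av k rk).
  by apply: generated_geq Mg; rewrite (catA x) E.
(* The last syllable once [c^j] has been handed to its left: [x c^i = h c^j (g j)]. *)
pose g j := nf (pw (c b) (- j)%R ++ m ++ pw (c b) i).
have sg j : syllable b (g j) by apply: syl => //; [apply: on_pw | exists (- j)%R].
have Eg j : geq (x ++ pw (c b) i) (h ++ pw (c (~~ b)) j ++ g j).
  rewrite xm /g (free_gp_eq w (nf_feq _)) -catA; apply: gp_eq_catl.
  by rewrite (geq_pw (~~ b) b) pwN gp_catKV.
(* If [c^i' (g j) c^k] were in [M b], multiplying it by the generated [h c^(j - i')] would make
   [x c^i c^k] generated. *)
have av_g j r (l : bool) : (forall k : int, r || (k == 0) ->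
      ~ generated (x ++ pw (c b) i ++ pw (c b) k)) ->
    (forall j' : int, l || (j' == j) -> generated (h ++ pw (c (~~ b)) j')) ->
    avoids l r b (g j).
  move=> av hP i' k li rk /M_generated Mg; apply: (av k rk).
  have {}hP : generated (h ++ pw (c (~~ b)) (j - i')%R).
    by apply: hP; case: (l) li => //= /eqP ->; apply/eqP; lia.
  apply: generated_geq (generated_cat hP Mg); rewrite (catA x) (Eg j) -!catA; apply: gp_eq_catl.
  rewrite !catA; do 2 apply: gp_eq_catr.
  by rewrite (geq_pw b (~~ b) i') -pwD (_ : (j - i' + i' = j)%R) //; lia.
split=> [|r av].
  have [[y Ey hy] _] := IH 0; exists (y ++ g 0); last exact: certificate_cat.
  by rewrite (Eg 0) catA Ey.
have up k : generated (h ++ pw (c (~~ b)) k) -> generated (h ++ pw (c (~~ b)) (k + 1)%R).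
  move=> hk; apply: generated_geq (generated_cat hk (generated_npow (~~ b) 1)).
  by rewrite -catA pwD.
case: (upward_closed_threshold up) => [hP|hP|[k [nPk Pk]]].
- have [[y Ey hy] _] := IH 0; exists (y ++ g 0); first by rewrite (Eg 0) catA Ey.
  by apply: certificate_left => //; apply: (av_g 0 r true av).
- have [_ /(_ true)[|y Ey hy]] := IH 0.
    by move=> k _; apply: hP.
  exists (y ++ g 0); first by rewrite (Eg 0) catA Ey.
  exact: certificate_all.
(* The word [h c^k], just below the threshold, takes the place of [h] in [certificate_step]; the [c]
   inserted there makes the exponent [k + 1]. *)
- have [_ /(_ false)[|y Ey hy]] := IH k.
    by move=> k' /= /eqP ->; rewrite cats0.
  exists (y ++ c (~~ b) ++ g (k + 1)%R).
    by rewrite (Eg (k + 1)%R) catA pwD -Ey pw1 -!catA.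
  by apply: certificate_step => //; apply: av_g => // j' /= /eqP ->.
Qed.

(** Certificates speak only of products with syllables outside [<c>]; the second alternative takes
    care of the powers of [c]. *)
Lemma not_generatedP x : ~ generated x <->
  (exists2 y, geq x y & exists b, certificate (Some false) b y) \/
  (exists2 g, geq x g & exists b, [/\ on b g, reduced g & avoids false false b g]).
Proof.
have not_av g b : on b g -> reduced g -> ~ generated g -> avoids false false b g.
  move=> gb rg nP i j /= /eqP -> /eqP -> /M_generated.
  by rewrite cats0.
split=> [nP|[[y xy [b /certificate_sound[_ yP]]]|[g xg [b [gb rg av]]]] xP].
- case: (power_or_alternating_word x) => [[k _ xk]|[b xA]].
    right; exists (nf (pw (c false) k)); first by rewrite (free_gp_eq w (nf_feq _)).
    exists false; split; [exact/on_nf/on_pw | exact: reduced_nf |].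
    apply: not_av; [exact/on_nf/on_pw | exact: reduced_nf |] => nfP; apply: nP.
    by apply: generated_geq nfP; rewrite (free_gp_eq w (nf_feq _)).
  left; have [_ /(_ false)[|y xy yb]] := certificate_complete 0 xA.
    by move=> k /= /eqP ->; rewrite !cats0.
  by exists y; [rewrite -xy cats0 | exists b].
- by apply: (yP 0) => //; rewrite cats0; apply: generated_geq xP; symmetry.
- apply: (av 0 0) => //; rewrite cats0; apply: generated_on => //.
  by apply: generated_geq xP; symmetry.
Qed.

Lemma not_geq_nilP x : ~ geq x [::] <->
  (exists2 y, geq x y & exists b, certificate None b y) \/
  (exists2 g, geq x g & exists b, [/\ on b g, reduced g & g <> [::]]).
Proof.
split=> [x1|[[y -> [b /certificate_sound[yA _]]]|[g -> [b [gb rg g0]]]] x1].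
- case: (power_or_alternating_word x) => [[k _ xk]|[b xA]].
    have {}xk : geq x (nf (pw (c false) k)) by rewrite (free_gp_eq w (nf_feq _)).
    right; exists (nf (pw (c false) k)) => //.
    exists false; split; [exact/on_nf/on_pw | exact: reduced_nf |].
    by move=> E; apply: x1; rewrite xk E.
  left; have [[y xy yb] _] := certificate_complete 0 xA.
  by exists y; [rewrite -xy cats0 | exists b].
- have [t [l [k]]] := alternating_geqE (fun _ _ => id) yA.
  by move/geq_nform: x1 => ->.
- by apply: g0; apply: reduced_feq => //; apply: (@geq_on b) x1.
Qed.
End Submonoid.
End Amalgam.

(** * Rational subsets of free groups *)

Section Benois.
Variable Z : finType.
Implicit Types (L : seq (word Z)) (LL : seq (seq (word Z))).

(* Benois: saturating the automaton by the paths whose labels are freely equal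
   to a letter turns freely equal labels into equal ones on reduced words. *)
Lemma regular_free_closure (Q : finType) (path : Q -> word Z -> Q -> Prop) q0 qf :
  (forall q t1 t2 q', path q (t1 ++ t2) q' <-> exists q1, path q t1 q1 /\ path q1 t2 q') ->
  exists2 L : seq (Z * bool) -> Prop, regular L &
    forall g, reduced g -> L g <-> exists2 t, path q0 t qf & feq t g.
Proof.
move=> cut; pose T q s q' := exists2 t, path q t q' & feq t s.
(* The subset construction, where reading a letter follows every path whose label is freely equal to
   that letter. *)
pose d (S : {set Q}) (a : Z * bool) := [set q' | `[< exists2 q, q \in S & T q [:: a] q' >]].
pose F (S : {set Q}) := `[< exists2 q, q \in S & T q [::] qf >].
exists (fun s => F (foldl d [set q0] s)); first by exists {set Q}, d, [set q0], F.
(* Reducedness is needed to cut a path with label freely equal to [a :: s] after the part freely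
   equal to [a]. *)
have T_cons a s q : reduced (a :: s : word Z) ->
    T q (a :: s) qf <-> exists q1, T q [:: a] q1 /\ T q1 s qf.
  move=> rs; split=> [[t qt]|[q1 [[t1 qt1 E1] [t2 qt2 E2]]]].
    rewrite -cat1s => /feq_cat_split[//|t1 [t2 [tE E1 E2]]].
    move: qt; rewrite tE => /cut[q1 [qt1 qt2]].
    by exists q1; split; [exists t1 | exists t2].
  exists (t1 ++ t2); first by apply/cut; exists q1.
  by rewrite E1 E2.
have FP s S : reduced (s : word Z) -> F (foldl d S s) <-> exists2 q, q \in S & T q s qf.
  elim: s S => [|a s IHs] S rs /=; first by split=> /asboolP.
  rewrite IHs; last by move: rs => /= /path_sorted.
  split=> [[q1 + qs]|[q Sq /(T_cons _ _ _ rs)[q1 [qa qs]]]].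
    by rewrite inE => /asboolP[q Sq qa]; exists q => //; apply/T_cons => //; exists q1.
  by exists q1 => //; rewrite inE; apply/asboolP; exists q.
move=> g rg; rewrite FP //; split=> [[q]|qg]; first by rewrite inE => /eqP ->.
by exists q0; rewrite ?inE.
Qed.

(** The product of the submonoids generated by the successive lists, as words:
    [L_1* L_2* ... L_n*]. *)
Inductive monoid_product : seq (seq (word Z)) -> word Z -> Prop :=
| mp_nil : monoid_product [::] [::]
| mp_skip L LL t : monoid_product LL t -> monoid_product (L :: LL) t
| mp_gen L LL l t : l \in L -> monoid_product (L :: LL) t -> monoid_product (L :: LL) (l ++ t).

(* A state is a final segment of [LL] and what remains of the factor being read. *)
Inductive run : seq (seq (word Z)) * word Z -> word Z -> seq (seq (word Z)) * word Z -> Prop :=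
| run_refl q : run q [::] q
| run_read LL a r t q : run (LL, r) t q -> run (LL, a :: r) (a :: t) q
| run_gen L LL l t q : l \in L -> run (L :: LL, l) t q -> run (L :: LL, [::]) t q
| run_skip L LL t q : run (LL, [::]) t q -> run (L :: LL, [::]) t q.

Lemma run_cat q t1 q1 t2 q' : run q t1 q1 -> run q1 t2 q' -> run q (t1 ++ t2) q'.
Proof.
move=> r1 r2; elim: r1 r2 => {q t1 q1} //.
- by move=> LL a r t q _ IH /IH; apply: run_read.
- by move=> L LL l t q lL _ IH /IH; apply: run_gen.
- by move=> L LL t q _ IH /IH; apply: run_skip.
Qed.

Lemma run_split q t q' : run q t q' -> forall t1 t2, t = t1 ++ t2 ->
  exists q1, run q t1 q1 /\ run q1 t2 q'.
Proof.
elim=> {q t q'}.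
- by move=> q [|a t1] // [|b t2] // _; exists q; split; apply: run_refl.
- move=> LL a r t q rt IH [|b t1] t2.
    by move=> /= <-; exists (LL, a :: r); split; [apply: run_refl | apply: run_read].
  by case=> <- /IH[q1 [r1 r2]]; exists q1; split=> //; apply: run_read.
- by move=> L LL l t q lL _ IH t1 t2 /IH[q1 [r1 r2]]; exists q1; split=> //; apply: run_gen r1.
- by move=> L LL t q _ IH t1 t2 /IH[q1 [r1 r2]]; exists q1; split=> //; apply: run_skip.
Qed.

Lemma monoid_product_run LL t : monoid_product LL t <-> run (LL, [::]) t ([::], [::]).
Proof.
split=> [|r].
  elim=> {LL t} [|L LL t _ IH|L LL l t lL _ IH]; [exact: run_refl | exact: run_skip |].
  by apply: run_gen lL _; elim: (l) => // a l' IHl; apply: run_read.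
suff gen q s q' : run q s q' -> q' = ([::], [::]) ->
    exists2 x, s = q.2 ++ x & monoid_product q.1 x.
  by have [x -> Hx] := gen _ _ _ r erefl.
elim=> {q s q'} [q|LL' a r' s q _ IH|L LL' l s q lL _ IH|L LL' s q _ IH] E /=.
- by rewrite E; exists [::] => //; apply: mp_nil.
- by have [x -> Hx] := IH E; exists x.
- by have [x -> Hx] := IH E; exists (l ++ x) => //; apply: mp_gen.
- by have [x -> Hx] := IH E; exists x => //; apply: mp_skip.
Qed.

Definition drops (T : Type) (s : seq T) := [seq drop i s | i <- iota 0 (size s).+1].

Lemma mem_drops (T : eqType) (s : seq T) i : drop i s \in drops s.
Proof.
have mem j : j <= size s -> drop j s \in drops s.
  by move=> le_j; apply: (map_f (fun i => drop i s)); rewrite mem_iota.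
case: (leqP i (size s)) => [/mem //|/ltnW/drop_oversize ->].
by rewrite -(drop_size s) mem.
Qed.

Lemma drops_cons (T : eqType) (a : T) (r s : seq T) : a :: r \in drops s -> r \in drops s.
Proof.
case/mapP=> i _ E; rewrite (_ : r = drop i.+1 s) ?mem_drops //.
by rewrite -add1n -drop_drop -E /= drop0.
Qed.

(** The automaton is finite because a run only meets final segments of [LL] paired with suffixes of
    generators. *)
Lemma regular_monoid_product LL :
  exists2 L : seq (Z * bool) -> Prop, regular L &
    forall g, reduced g -> L g <-> exists2 t, monoid_product LL t & feq t g.
Proof.
pose S : seq (word Z) := [::] :: flatten [seq drops l | l <- flatten LL].
pose E := [seq (LL', r) | LL' <- drops LL, r <- S].
have ES q t q' : run q t q' -> q \in E -> q' \in E.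
  have EP LL' r : ((LL', r) \in E) = (LL' \in drops LL) && (r \in S).
    by apply/allpairsP/andP=> [[[x y] /= [? ? [-> ->]]]|[? ?]] //; exists (LL', r).
  elim=> {q t q'} // [LL' a r t q _ IH|L LL' l t q lL _ IH|L LL' t q _ IH];
    rewrite EP => /andP[dLL rS]; apply: IH; rewrite EP.
  - rewrite dLL /=; move: rS; rewrite !inE /= => /flattenP[s /mapP[l lLL ->] /drops_cons rs].
    by apply/orP; right; apply/flattenP; exists (drops l) => //; apply: map_f.
  - rewrite dLL inE; apply/orP; right; apply/flattenP; exists (drops l).
      apply: map_f; apply/flattenP; exists L => //.
      by case/mapP: dLL => i _ LE; have := mem_head L LL'; rewrite LE => /mem_drop.
    by rewrite -{1}[l]drop0 mem_drops.
  - by rewrite (drops_cons dLL).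
have E0 : (LL, [::]) \in E.
  by apply: allpairs_f; rewrite ?mem_head // -{1}[LL]drop0 mem_drops.
have Ef : ([::], [::]) \in E.
  by apply: allpairs_f; rewrite ?mem_head // -(drop_size LL) mem_drops.
pose runE (q : seq_sub E) t (q' : seq_sub E) := run (val q) t (val q').
have [|L rL LP] := @regular_free_closure _ runE (SeqSub E0) (SeqSub Ef).
  move=> q t1 t2 q'; split=> [/run_split/(_ _ _ erefl)[q1 [r1 r2]]|[q1 [r1 r2]]].
    by exists (SeqSub (ES _ _ _ r1 (valP q))).
  exact: run_cat r1 r2.
exists L => // g rg; rewrite LP //.
by split=> -[t tP tg]; exists t => //; apply/monoid_product_run.
Qed.
End Benois.

(** * Presented inverse monoids *)

#[export] Hint Extern 0 (inv_eq _ _ _) => exact: cg_refl : core.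
#[export] Hint Extern 0 (congruence_gen _ _ _) => exact: cg_refl : core.

Section InverseMonoid.
Variables (Z : Type) (w : word Z).
Implicit Types p q r x y f : word Z.
Local Notation "p ~~ q" := (inv_eq w p q) (at level 70).

Global Instance inv_eq_Equivalence : Equivalence (inv_eq w).
Proof.
split=> [p|p q|p q r]; [exact: cg_refl | exact: cg_sym | exact: cg_trans].
Qed.

Global Instance inv_eq_cat : Proper (inv_eq w ==> inv_eq w ==> inv_eq w) cat.
Proof. by move=> p p' pp' q q'; apply: cg_cat. Qed.

Lemma inv_eq_catl x p q : p ~~ q -> x ++ p ~~ x ++ q.
Proof. by move=> E; rewrite E. Qed.

Lemma inv_eq_catr x p q : p ~~ q -> p ++ x ~~ q ++ x.
Proof. by move=> E; rewrite E. Qed.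

Lemma catKV_regular p x : p ++ winv p ++ p ++ x ~~ p ++ x.
Proof. by have := inv_eq_catr x (cg_rel (inv_regular w p)); rewrite -!catA. Qed.

Lemma catV_regular p : p ++ winv p ++ p ~~ p.
Proof. exact: cg_rel (inv_regular w p). Qed.

Lemma catVK_regular p x : winv p ++ p ++ winv p ++ x ~~ winv p ++ x.
Proof. by have := catKV_regular (winv p) x; rewrite winvK. Qed.

Lemma idempotents_comm p q x : p ++ winv p ++ q ++ winv q ++ x ~~ q ++ winv q ++ p ++ winv p ++ x.
Proof. by have := inv_eq_catr x (cg_rel (inv_idempotents w p q)); rewrite -!catA. Qed.

Global Instance inv_eq_winv : Proper (inv_eq w ==> inv_eq w) (@winv Z).
Proof.
move=> p q; elim=> {p q} [p q [{}p|{}p {}q|]|//|p q _ IH|p q r _ IH1 _ IH2|p p' q q' _ IH1 _ IH2].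
- by have := catVK_regular p [::]; rewrite !winv_cat winvK !cats0 -catA.
- by rewrite !winv_cat !winvK -!catA; have := idempotents_comm q p [::]; rewrite !cats0.
- have w1 : w ~~ [::] by apply: cg_rel (inv_relator w).
  have E : w ++ winv w ++ w ~~ [::] ++ winv w ++ [::] by exact: cg_cat w1 (cg_cat (cg_refl _ _) w1).
  rewrite cats0 /= in E; apply: cg_trans (cg_sym E) _.
  exact: cg_trans (cg_rel (inv_regular w w)) w1.
- by symmetry.
- by rewrite IH1.
- by rewrite !winv_cat IH1 IH2.
Qed.

(** The natural partial order of an inverse monoid: [p] is the restriction of [q] by the idempotent
    [p p^-1]. *)
Definition ile p q := p ~~ p ++ winv p ++ q.

Lemma idempotent_ile f p q : p ~~ f ++ winv f ++ q -> ile p q.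
Proof.
move=> E; apply: (cg_trans E); symmetry.
apply: cg_trans (cg_cat E (cg_cat (inv_eq_winv E) (cg_refl _ q))) _.
rewrite !winv_cat winvK -!catA (idempotents_comm q f q) catKV_regular.
by rewrite catV_regular.
Qed.

Lemma inv_eq_ile p q : p ~~ q -> ile p q.
Proof.
move=> E; apply: (@idempotent_ile q); rewrite E.
by rewrite catV_regular.
Qed.

Lemma ile_refl p : ile p p. Proof. exact: inv_eq_ile. Qed.

Lemma idempotent_ile1 f : ile (f ++ winv f) [::].
Proof. by apply: (@idempotent_ile f); rewrite cats0. Qed.

Lemma ile_trans q p r : ile p q -> ile q r -> ile p r.
Proof.
move=> pq qr; have E : p ++ winv p ~~ p ++ winv p ++ q ++ winv q.
  apply: cg_trans (cg_cat pq (inv_eq_winv pq)) _; rewrite !winv_cat winvK -!catA.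
  have := idempotents_comm q p [::]; rewrite !cats0 => ->.
  by rewrite catKV_regular.
by rewrite /ile catA E -!catA -qr.
Qed.

Lemma ile_catl x p q : ile p q -> ile (x ++ p) (x ++ q).
Proof.
move=> pq; rewrite /ile winv_cat -!catA.
have := idempotents_comm p (winv x) q; rewrite winvK => ->.
by rewrite catKV_regular -pq.
Qed.

Lemma ile_catr y p q : ile p q -> ile (p ++ y) (q ++ y).
Proof. by move=> pq; apply: (@idempotent_ile p); rewrite {1}pq -!catA. Qed.

Lemma ile_cat p p' q q' : ile p p' -> ile q q' -> ile (p ++ q) (p' ++ q').
Proof. by move=> pp' qq'; apply: ile_trans (ile_catr _ pp') (ile_catl _ qq'). Qed.

Lemma ile_antisym p q : ile p q -> ile q p -> p ~~ q.
Proof.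
move=> pq qp; apply: (cg_trans pq); apply: cg_trans (inv_eq_catl p (inv_eq_catl _ qp)) _.
by rewrite (idempotents_comm p q p) catV_regular -qp.
Qed.

Lemma ile_winv p q : ile p q -> ile (winv p) (winv q).
Proof.
move=> pq; have pV : winv p ~~ winv q ++ p ++ winv p.
  by have := inv_eq_winv pq; rewrite !winv_cat winvK -!catA.
have E : q ++ winv p ++ p ~~ p.
  apply: cg_trans (inv_eq_catl q (cg_cat pV pq)) _; rewrite -!catA catKV_regular.
  rewrite (idempotents_comm q p q); rewrite catV_regular.
  by rewrite -pq.
have := inv_eq_winv E; rewrite !winv_cat winvK -!catA => {}E.
by rewrite /ile winvK E.
Qed.

Lemma right_unit_maximal t q : t ++ winv t ~~ [::] -> ile t q -> t ~~ q.
Proof. by move=> t1 tq; rewrite tq catA t1. Qed.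

Lemma inv_eq_gp_eq p q : p ~~ q -> gp_eq w p q.
Proof.
elim=> {p q} [p q [{}p|{}p {}q|]|//|p q _ IH|p q r _ IH1 _ IH2|p p' q q' _ IH1 _ IH2].
- by rewrite gp_catKV.
- by rewrite !gp_catKV !gp_catV.
- exact: cg_rel (gp_relator w).
- by symmetry.
- by rewrite IH1.
- by rewrite IH1 IH2.
Qed.

Lemma ile_gp_eq p q : ile p q -> gp_eq w p q.
Proof. by move/inv_eq_gp_eq; rewrite gp_catKV. Qed.
End InverseMonoid.

(** Each cancellation replaces an idempotent [a^-1 a] by 1, which can only go up. *)
Lemma ile_nf (Z : eqType) (w p : word Z) : ile w p (nf p).
Proof.
suff E s : ile w (rev s ++ p) (rev (foldl (@push Z) s p)) by apply: (E [::]).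
elim: p s => [|a p IHp] s /=; first by rewrite cats0; apply: ile_refl.
apply: ile_trans (IHp _); case: s => [|b s] /=; first exact: ile_refl.
case: (b =P linv a) => [->|_]; last by rewrite !rev_cons -!cats1 -!catA; apply: ile_refl.
rewrite rev_cons -cats1 -catA; apply: ile_catl.
rewrite -[_ ++ a :: p]/(([:: linv a] ++ [:: a]) ++ p) -{2}[p]cat0s; apply: ile_catr.
by have := idempotent_ile1 w [:: linv a]; rewrite /winv /= linvK.
Qed.

(** * Prefix coverage *)

Section Coverage.
Variables (Z : eqType) (w : word Z).
Implicit Types p q x y : word Z.

(* The Schuetzenberger graph of [p] has vertices [p' r] with [p'] a prefix of [p]
   and [r] in the prefix monoid. *)
Definition covers p x := exists i, prefix_monoid w (winv (take i p) ++ x).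

Lemma prefix_monoid_geq x y : gp_eq w x y -> prefix_monoid w x <-> prefix_monoid w y.
Proof. by move=> E; split; apply: pm_eq; [|symmetry]. Qed.

Lemma covers_geq p x y : gp_eq w x y -> covers p x <-> covers p y.
Proof.
by move=> E; split=> -[i Hi]; exists i; apply: pm_eq Hi; rewrite E.
Qed.

Lemma covers_nil x : covers [::] x <-> prefix_monoid w x.
Proof. by split=> [[i]|]; [|exists 0]. Qed.

(** The graph of [p q] is that of [p] together with the translate by [p] of that of [q]. *)
Lemma covers_cat p q x : covers (p ++ q) x <-> covers p x \/ covers q (winv p ++ x).
Proof.
split=> [[i]|[[i Hi]|[i Hi]]].
- rewrite take_cat; case: ltnP => _ Hi; first by left; exists i.
  by right; exists (i - size p); move: Hi; rewrite winv_cat -catA.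
- exists (minn i (size p)); rewrite take_cat; case: ltnP => [lt_i|ge_i].
    by rewrite (minn_idPl _) //; lia.
  rewrite (_ : minn _ _ - _ = 0) ?take0 ?cats0; last by lia.
  by rewrite take_oversize in Hi => //; lia.
- by exists (size p + i); rewrite take_cat ltnNge leq_addr /= addKn winv_cat -catA.
Qed.

(** The path of [winv p] read from the end of [p] visits the same vertices backwards. *)
Lemma covers_winv p x : covers (winv p) (winv p ++ x) <-> covers p x.
Proof.
have E j : gp_eq w (winv (winv (drop j p)) ++ winv p ++ x) (winv (take j p) ++ x).
  by rewrite winvK -{2}[p](cat_take_drop j) winv_cat -catA gp_catKV.
have tE i : take i (winv p) = winv (drop (size p - i) p).
  by rewrite /winv take_rev size_map map_drop.
split=> [[i]|[j Hj]].
  by rewrite tE => /(prefix_monoid_geq (E _)) Hi; exists (size p - i).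
have [le_j|lt_j] := leqP j (size p).
  by exists (size p - j); rewrite tE subKn //; apply/(prefix_monoid_geq (E _)).
exists 0; rewrite tE; apply/(prefix_monoid_geq (E _)).
by move: Hj; rewrite !take_oversize //; lia.
Qed.

Lemma prefix_monoid_prefix i : prefix_monoid w (take i w).
Proof. by apply: pm_prefix; apply: prefix_take. Qed.

(** The two sides of a Vagner relation visit the same vertices, and the relator visits only prefixes
    of [w], which already hang from the origin. *)
Lemma covers_inv_eq p q : inv_eq w p q -> forall x, covers p x <-> covers q x.
Proof.
have cov1 x : covers w x <-> prefix_monoid w x.
  split=> [[i Hi]|Hx]; last by exists 0; rewrite take0.
  apply: pm_eq (pm_mul (prefix_monoid_prefix i) Hi); exact: gp_catKV.
have covpp r x : covers r x <-> covers (r ++ winv r) x.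
  by rewrite covers_cat covers_winv; tauto.
elim=> {p q} [p1 q1 R1|p1|p1 q1 _ IH|p1 q1 r1 _ IH1 _ IH2|p1 p2 q1 q2 E1 IH1 _ IH2] x //.
- case: R1 => {p1 q1} [p|p q|]; last by rewrite cov1 covers_nil.
    rewrite catA covers_cat -covpp winv_cat winvK -catA.
    by rewrite (covers_geq _ (gp_catKV _ _ _)); tauto.
  rewrite !(catA p) !(catA q) (covers_cat (p ++ _)) (covers_cat (q ++ _)) -!covpp.
  have E r : gp_eq w (winv (r ++ winv r) ++ x) x by rewrite gp_catV.
  by rewrite (covers_geq _ (E p)) (covers_geq _ (E q)); tauto.
- by rewrite IH.
- by rewrite IH1.
- rewrite !covers_cat IH1 IH2.
  by rewrite (covers_geq _ (gp_eq_catr x (gp_eq_winv (inv_eq_gp_eq E1)))).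
Qed.

(** For a prefix [r] of [w], [r r^-1 w = w], and [w = 1]. Group equality may leave the right units,
    whence the representative [r0]. *)
Lemma prefix_monoid_right_unit r : prefix_monoid w r ->
  exists2 r0, gp_eq w r r0 & inv_eq w (r0 ++ winv r0) [::].
Proof.
elim=> {r} [r /prefixP[r' wE]|||]; last first.
- by move=> p q pq _ [r0 pr0 r1]; exists r0; rewrite // -pq.
- move=> p q _ [p0 pp0 p1] _ [q0 qq0 q1]; exists (p0 ++ q0); first by rewrite pp0 qq0.
  by rewrite winv_cat -!catA (catA q0) q1.
- by exists [::].
have w1 : inv_eq w w [::] := cg_rel (inv_relator w).
have E : inv_eq w (r ++ winv r ++ w) w by have := catKV_regular w r r'; rewrite -wE.
have E' := inv_eq_catl r (inv_eq_catl (winv r) w1); rewrite cats0 in E'.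
by exists r => //; apply: cg_trans (cg_sym E') (cg_trans E w1).
Qed.
End Coverage.

(** * Inverse monoids of amalgamated products *)

Section AmalgamInverseMonoid.
Variables (Z : choiceType) (side : Z -> bool) (c : bool -> word Z).
Hypothesis c_reduced : forall b, reduced (c b).
Hypothesis c_neq0 : forall b, c b <> [::].
Hypothesis c_on : forall b, on side b (c b).

Let w := c false ++ winv (c true).
Local Notation ieq := (inv_eq w).
Local Notation ile := (ile w).
Local Notation geq := (gp_eq w).

(** The relation makes [c true] a right unit, and [c true = c false (c true)^-1 (c true)] lies below
    [c false]; right units are maximal. *)
Lemma inv_eq_c b b' : ieq (c b) (c b').
Proof.
have w1 : ieq (c false ++ winv (c true)) [::] := cg_rel (inv_relator w).
have right_unit x y : ieq (x ++ winv y) [::] -> ieq (x ++ winv x) [::].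
  move=> xy; have := inv_eq_catl x (inv_eq_catl (winv x) xy).
  by rewrite catKV_regular cats0 xy; symmetry.
have E : ieq (c true) (c false).
  apply: right_unit_maximal.
    by apply: (right_unit _ (c false)); have := inv_eq_winv w1; rewrite winv_cat winvK.
  have le := ile_catl (c false) (idempotent_ile1 w (winv (c true))).
  apply: ile_trans (_ : ile (c true) _) _; last by rewrite cats0 in le; exact: le.
  by apply: inv_eq_ile; rewrite winvK catA w1.
by case: b b' => [] [] //; symmetry.
Qed.

Lemma right_unit_npow b n : ieq (npow (c b) n ++ winv (npow (c b) n)) [::].
Proof.
elim: n => // n IHn; rewrite [npow _ _]/(c b ++ npow (c b) n) winv_cat -catA (catA (npow _ _)) IHn.
rewrite {1}(inv_eq_c b false) (inv_eq_winv (inv_eq_c b true)).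
exact: cg_rel (inv_relator w).
Qed.

Lemma inv_eq_pw b b' k : ieq (pw (c b) k) (pw (c b') k).
Proof.
have nE n : ieq (npow (c b) n) (npow (c b') n).
  by elim: n => //= n IHn; rewrite IHn; apply: inv_eq_catr; apply: inv_eq_c.
by case: k => n; rewrite /pw ?nE.
Qed.

(** A non-negative power of [c] is a right unit, hence equal to its free reduction, which is above
    [m]. Negative powers follow by inversion. *)
Lemma ile_pw b b' m k : feq m (pw (c b) k) -> ile m (pw (c b') k).
Proof.
have le_npow n x : feq x (npow (c b) n) -> ile x (npow (c b) n).
  move/feq_nf => E; apply: ile_trans (ile_nf w x) _; rewrite E.
  apply: inv_eq_ile; symmetry; apply: right_unit_maximal (right_unit_npow b n) _.
  exact: ile_nf.
move=> E; apply: ile_trans (inv_eq_ile (inv_eq_pw b b' k)).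
case: k E => n E; first exact: le_npow.
rewrite -[m]winvK; apply: ile_winv; apply: le_npow.
by rewrite E /pw winvK.
Qed.

(* With [g] empty this says that the inverse monoid is E-unitary. *)
Lemma geq_ile b s g : geq s g -> on side b g -> reduced g -> ile s g.
Proof.
move=> sg gb rg; have le_feq x : feq x g -> ile x g.
  by move/feq_nf => E; have := ile_nf w x; rewrite E nf_reduced.
have : power_or_alternating c (on side) ile s.
  have -> : s = flatten [seq [:: a] | a <- s] by elim: (s) => //= a x {1}->.
  apply: power_or_alternating_flatten => //.
  - by move=> b' m m'; rewrite on_cat => -> ->.
  - by move=> b' b'' m k _ _; apply: on_pw.
  - exact: ile_refl.
  - by move=> p q r; apply: ile_trans.
  - by move=> p p' q q'; apply: ile_cat.
  - by move=> b' b'' m k _; apply: ile_pw.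
  by move=> m /mapP[a _ ->]; exists (side a.1); rewrite /= eqxx.
have geq_feq := geq_on c_reduced c_neq0 c_on.
case=> [[k _ sk]|[b' alt]].
  apply: (ile_trans sk); apply: ile_trans (inv_eq_ile (inv_eq_pw false b k)) _.
  apply: le_feq; apply: (geq_feq b) => //; first exact: on_pw.
  by rewrite -sg (ile_gp_eq sk); apply: geq_pw.
have [t [l [k]]] := alternating_nform c_reduced c_neq0 c_on (fun _ _ => id) (@ile_gp_eq _ w) alt.
have nfE p q := geq_nform c_reduced c_neq0 c_on p q.
have nf_on := nform_on c_reduced c_neq0 c_on.
move/nfE: (sg) => ->; rewrite (nf_on b) // /split; case: (coset_rep _ _ b g) => // a t' [bb' _ El _].
move: alt; rewrite -bb' => /alternating_inv[[m [mb mA sm]]|[h [m [hA mb mA shm]]]].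
  apply: (ile_trans sm); apply: le_feq; apply: (geq_feq b) => //.
  by rewrite -sg (ile_gp_eq sm).
have [t1 [l' [k' E]]] := alternating_nform c_reduced c_neq0 c_on (fun _ _ => id) (@ile_gp_eq _ w) hA.
have /nfE : geq g (h ++ m) by rewrite -sg (ile_gp_eq shm).
rewrite (nform_cat c_reduced c_neq0 c_on E mb mA) (nf_on b) // /split.
by case: (coset_rep _ _ b g).
Qed.

Lemma conj_idempotent f y : ieq ((f ++ winv f ++ y) ++ winv (f ++ winv f ++ y))
  (f ++ winv f ++ y ++ winv y).
Proof.
rewrite !winv_cat winvK -!catA.
have := idempotents_comm w y f [::]; rewrite !cats0 => ->.
by rewrite catKV_regular.
Qed.

(** By induction on the prefixes [q'] of [q], the idempotent [p p^-1] absorbs [q' q'^-1]: the path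
    of [q] can be read inside the graph of [p]. *)
Lemma covered_ile p q : (forall i, covers w p (take i q)) -> geq p q -> ile p q.
Proof.
move=> cov pq; have claim i : ieq (p ++ winv p ++ take i q ++ winv (take i q)) (p ++ winv p).
  elim: i => [|i IHi]; first by rewrite take0 cats0.
  case: (ltnP i (size q)) => [lt_i|ge_i]; last by move: IHi; rewrite !take_oversize // ltnW.
  have := cov i.+1; case: (q) lt_i IHi => // a0 q0; move: (a0 :: q0) => {q0} q1 lt_i.
  rewrite (take_nth a0) // -cats1; set q' := take i q1; set a := nth a0 q1 i => IHi.
  case=> j /prefix_monoid_right_unit[r0 r0E r01].
  (* In the group, [x] is [q'] and [z] is the next vertex [q' a], reached inside the graph of [p] by
     the right unit [r0]. Both restrict to the idempotent [p p^-1]. *)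
  set p' := take j p in r0E; pose x := p ++ winv p ++ q'; pose z := p ++ winv p ++ p' ++ r0.
  have xV : ieq (x ++ winv x) (p ++ winv p) by rewrite conj_idempotent IHi.
  have zV : ieq (z ++ winv z) (p ++ winv p).
    rewrite conj_idempotent winv_cat -!catA (catA r0) r01 /=.
    have := idempotents_comm w p p' [::]; rewrite !cats0 => ->.
    by have := catKV_regular w p' (drop j p ++ winv p); rewrite !(catA p' (drop j p)) cat_take_drop.
  have zE : geq z (q' ++ [:: a]) by rewrite /z gp_catKV -r0E gp_catKV.
  (* By [geq_ile] the edge from [z] back to [x] is below the letter [a^-1]; so [x = z a^-1], and
     [a a^-1] can be appended to [x]. *)
  have le : ile (winv z ++ x) [:: linv a].
    apply: (@geq_ile (side a.1)); rewrite /= ?eqxx // zE /x gp_catKV winv_cat -catA gp_Vcat.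
    by rewrite cats0.
  have xz : ieq x (z ++ [:: linv a]).
    have := ile_catl z le; rewrite catA => /(ile_trans _) le'.
    have {le'} : ile x (z ++ [:: linv a]).
      by apply: le'; apply: inv_eq_ile; rewrite zV /x -catA catKV_regular.
    move=> le'; apply: cg_trans le' _; rewrite catA xV /z -!catA.
    by rewrite catKV_regular.
  have xa : ieq (x ++ [:: a] ++ [:: linv a]) x.
    rewrite xz -catA; apply: inv_eq_catl.
    by have := catV_regular w [:: linv a]; rewrite {1}/winv /= linvK.
  rewrite winv_cat; apply: cg_trans IHi; have := inv_eq_catr (winv q') xa.
  by rewrite /x -!catA.
(* E-unitarity gives [p p^-1 q] below [p]; by the claim both have the same idempotent [p p^-1], so
   they are equal. *)
have le1 : ile (winv p ++ q) [::] by apply: (@geq_ile true) => //; apply/gp_Vcat1.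
have := ile_catl p le1; rewrite cats0 => xp.
apply: cg_sym; apply: cg_trans xp _; rewrite catA conj_idempotent.
by have := claim (size q); rewrite take_size => ->; rewrite -catA catV_regular.
Qed.

Lemma inv_eqP p q : inv_eq w p q <->
  [/\ geq p q, forall i, covers w q (take i p) & forall i, covers w p (take i q)].
Proof.
split=> [pq|[pq cov_q cov_p]]; last first.
  by apply: ile_antisym; apply: covered_ile => //; symmetry.
have cov r i : covers w r (take i r).
  by exists i; apply: pm_eq (pm_one _); rewrite gp_Vcat.
split=> [|i|i]; first exact: inv_eq_gp_eq.
  by rewrite -(covers_inv_eq pq).
by rewrite (covers_inv_eq pq).
Qed.
End AmalgamInverseMonoid.

(** * Enumerability of the relations of a presentation *)

Instance encodable_word (Z : finType) : encodable (word Z) := encodable_seq (Z * bool)%type.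

Section Presentations.
Variables (Z : finType) (w : word Z).

Lemma RE_gp_eq : RE (fun z : word Z * word Z => gp_eq w z.1 z.2).
Proof.
apply: RE_congruence.
apply: (RE_ext (P := fun z : word Z * word Z =>
  (exists2 a, a \in enum {: Z * bool} & z.1 = [:: a; linv a] /\ z.2 = [::]) \/ z.1 = w /\ z.2 = [::])).
  apply: RE_or; last by apply: RE_and; apply: RE_eq; computable_solve.
  by apply: RE_has => a; apply: RE_and; apply: RE_eq; computable_solve.
case=> p q; split=> /= [[[a _ [-> ->]]|[-> ->]]|[a|]].
- exact: gp_free.
- exact: gp_relator.
- by left; exists a; rewrite ?mem_enum.
- by right.
Qed.

(** Enumerating the graph is enough: an existential quantifier over the second word replaces the
    computation of the inverse. *)
Lemma RE_winv : RE (fun z : word Z * word Z => z.2 = winv z.1).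
Proof.
pose step (z z' : word Z * word Z) := exists2 a, a \in enum {: Z * bool} &
  z' = (a :: z.1, z.2 ++ [:: linv a]).
have re_step : RE (fun z => step z.1 z.2).
  by apply: RE_has => a; apply: RE_eq; computable_solve.
apply: (RE_ext (P := fun z => clos_refl_trans_1n _ step ([::], [::]) z)).
  by apply: RE_rel (RE_star re_step) _ _; computable_solve.
case=> p q; split=> /= [st|->].
  suff gen z z' : clos_refl_trans_1n _ step z z' -> z.2 = winv z.1 -> z'.2 = winv z'.1.
    exact: (gen _ _ st).
  elim=> // {st p q} {}z z1 z2 [a _ ->] _ IH zE; apply: IH.
  by rewrite winv_cons /= zE.
elim: p => [|a p IHp]; first exact: rt1n_refl.
apply: clos_rt_rt1n; apply: rt_trans (clos_rt1n_rt _ _ _ _ IHp) _; apply: rt_step.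
by exists a; rewrite ?mem_enum // winv_cons.
Qed.

Lemma RE_inv_eq : RE (fun z : word Z * word Z => inv_eq w z.1 z.2).
Proof.
have rV T (eT : encodable T) (f g : T -> word Z) :
    computable f -> computable g -> RE (fun x => g x = winv (f x)).
  exact: (RE_rel (R := fun p q => q = winv p) RE_winv).
apply: RE_congruence.
pose reg (z : word Z * word Z) := exists p p',
  p' = winv p /\ z.1 = p ++ p' ++ p /\ z.2 = p.
pose idem (z : word Z * word Z) := exists p p' q q', (p' = winv p /\ q' = winv q) /\
  z.1 = p ++ p' ++ q ++ q' /\ z.2 = q ++ q' ++ p ++ p'.
apply: (RE_ext (P := fun z => reg z \/ idem z \/ z.1 = w /\ z.2 = [::])).
  apply: RE_or; last apply: RE_or.
  - do 2 apply: RE_ex; apply: RE_and; first by apply: rV; computable_solve.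
    by apply: RE_and; apply: RE_eq; computable_solve.
  - do 4 apply: RE_ex; apply: RE_and; apply: RE_and.
    1,2: by apply: rV; computable_solve.
    1,2: by apply: RE_eq; computable_solve.
  - by apply: RE_and; apply: RE_eq; computable_solve.
case=> p q; split=> /=.
  case=> [[x [x' [-> [/= -> ->]]]]|[[x [x' [y [y' [[-> ->] [/= -> ->]]]]]]|[-> ->]]].
  - exact: inv_regular.
  - exact: inv_idempotents.
  - exact: inv_relator.
case=> [x|x y|]; [left | right; left | by right; right].
  by exists x, (winv x).
by exists x, (winv x), y, (winv y).
Qed.

Lemma RE_prefix_monoid : RE (prefix_monoid w).
Proof.
pose step (x y : word Z) := exists2 i, i \in iota 0 (size w).+1 & y = x ++ take i w.
have re_step : RE (fun z => step z.1 z.2).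
  by apply: RE_has => i; apply: RE_eq; computable_solve.
have catl x y y' : clos_refl_trans _ step y y' -> clos_refl_trans _ step (x ++ y) (x ++ y').
  elim=> {y y'} [y _ [i ri ->]|y|y y1 y2 _ IH1 _ IH2].
  - by apply: rt_step; exists i; rewrite // catA.
  - exact: rt_refl.
  - exact: rt_trans IH1 IH2.
apply: (RE_ext (P := fun x => exists y, clos_refl_trans_1n _ step [::] y /\ gp_eq w y x)).
  apply: RE_ex; apply: RE_and.
    by apply: RE_rel (RE_star re_step) _ _; computable_solve.
  by apply: RE_rel RE_gp_eq _ _; computable_solve.
move=> x; split=> [[y [st yx]]|Px].
  apply: pm_eq yx _; move: (pm_one w); elim: st => // {x y} x y z [i _ ->] _ IH Px.
  by apply/IH/pm_mul/prefix_monoid_prefix.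
suff [y [st yx]] : exists y, clos_refl_trans _ step [::] y /\ gp_eq w y x.
  by exists y; split=> //; apply: clos_rt_rt1n.
elim: Px => {x} [x|||].
- rewrite prefixE => /eqP xE; exists x; split=> //.
  have le_x : size x <= size w by rewrite -{1}xE size_take_min geq_minr.
  by apply: rt_step; exists (size x); [rewrite mem_iota | rewrite /= xE].
- by exists [::]; split=> //; apply: rt_refl.
- move=> x x' _ [y [st yx]] _ [y' [st' yx']]; exists (y ++ y'); split; last by rewrite yx yx'.
  by apply: rt_trans st _; have := catl y _ _ st'; rewrite cats0.
- by move=> x x' xx' _ [y [st yx]]; exists y; split=> //; rewrite yx.
Qed.

(** Non-coverage is a conjunction over all prefixes of [p]. It becomes a path that consumes [p],
    multiplies [x] by the inverse of each letter and checks non-membership on the way. *)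
Lemma RE_not_covers : RE (fun x => ~ prefix_monoid w x) ->
  RE (fun z => ~ covers w z.1 z.2).
Proof.
move=> reN; pose step (z z' : word Z * word Z) := exists2 a, a \in enum {: Z * bool} &
  exists p, z.1 = a :: p /\ z' = (p, linv a :: z.2) /\ ~ prefix_monoid w z.2.
have re_step : RE (fun z => step z.1 z.2).
  apply: RE_has => a; apply: RE_ex; apply: RE_and; first by apply: RE_eq; computable_solve.
  by apply: RE_and; [apply: RE_eq | apply: (RE_preim reN)]; computable_solve.
apply: (RE_ext (P := fun z => exists x, clos_refl_trans_1n _ step z ([::], x) /\ ~ prefix_monoid w x)).
  apply: RE_ex; apply: RE_and; last by apply: (RE_preim reN); computable_solve.
  by apply: RE_rel (RE_star re_step) _ _; computable_solve.
have cov_cons a p x : covers w (a :: p) x <-> prefix_monoid w x \/ covers w p (linv a :: x).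
  split=> [[[|i] Hi]|[Px|[i Hi]]]; [by left | right; exists i | by exists 0 | exists i.+1].
    by move: Hi; rewrite [take _ _]/= winv_cons -catA.
  by rewrite [take _ _]/= winv_cons -catA.
case=> p x; split=> /= [[y [st Py]]|].
  suff gen z z' : clos_refl_trans_1n _ step z z' -> ~ covers w z'.1 z'.2 -> ~ covers w z.1 z.2.
    by apply: (gen _ _ st); rewrite covers_nil.
  elim=> // {st p x y Py} {}z z1 z2 [a _ [p [zE [-> Pz]]]] _ IH /IH.
  by rewrite zE cov_cons /= => nc [].
elim: p x => [|a p IHp] x; first by rewrite covers_nil => Px; exists x; split=> //; apply: rt1n_refl.
rewrite cov_cons => /not_orP[Px /IHp[y [st Py]]]; exists y; split=> //.
by apply: rt1n_trans st; exists a; rewrite ?mem_enum //; exists p.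
Qed.
End Presentations.

Lemma monoid_product_nil (Z : finType) (t : word Z) : monoid_product [::] t <-> t = [::].
Proof.
split=> [|->]; last exact: mp_nil.
move E: [::] => LL tP; by case: tP E.
Qed.

Lemma monoid_product_cons (Z : finType) (L : seq (word Z)) LL t : monoid_product (L :: LL) t <->
  exists s x, [/\ {subset s <= L}, monoid_product LL x & t = flatten s ++ x].
Proof.
split=> [|[s [x [+ xLL ->]]]]; last first.
  elim: s => [|l s IHs] sL; first exact: mp_skip.
  rewrite /= -catA; apply: mp_gen; first by apply: sL; rewrite mem_head.
  by apply: IHs => l' l's; apply: sL; rewrite inE l's orbT.
move E: (L :: LL) => LL' tP; elim: tP E => // {LL' t} L' LL' t.
  by move=> tP _ [_ ->]; exists [::], t.
move=> t' lL _ IH E; have [s [x [sL xLL ->]]] := IH E; case: E => EL _.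
exists (t :: s), x; split; rewrite /= ?catA // => l'.
by rewrite inE => /orP[/eqP -> |/sL //]; rewrite EL.
Qed.

(** * Prefixes of the two factors *)

Section PrefixMonoid.
Variables (Z : finType) (side : Z -> bool) (c : bool -> word Z).
Hypothesis c_reduced : forall b, reduced (c b).
Hypothesis c_neq0 : forall b, c b <> [::].
Hypothesis c_on : forall b, on side b (c b).

Let w := c false ++ winv (c true).
Local Notation geq := (gp_eq w).
Local Notation on := (on side).
Local Notation in_amalgam := (in_amalgam c).

Definition prefixes b : seq (word Z) := [seq take i (c b) | i <- iota 0 (size (c b)).+1].

Lemma mem_prefixes b i : take i (c b) \in prefixes b.
Proof.
have mem j : j <= size (c b) -> take j (c b) \in prefixes b.
  by move=> le_j; apply: (map_f (fun i => take i (c b))); rewrite mem_iota.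
by case: (leqP i (size (c b))) => [/mem //|/ltnW/take_oversize ->]; rewrite -(take_size (c b)) mem.
Qed.

(* The prefixes of [c b] generate the inverse of [c b] on one of the two sides;
   the amalgamated subgroup is then contained in the prefix monoid. *)
Definition inverse_generated :=
  exists b, exists2 s, {subset s <= prefixes b} & feq (flatten s) (winv (c b)).

Definition factor_generators b : seq (word Z) :=
  prefixes b ++ (if `[< inverse_generated >] then [:: winv (c b)] else [::]).

Definition factor_monoid b m :=
  on b m /\ exists2 s, {subset s <= factor_generators b} & feq (flatten s) m.

Lemma on_factor_generators b l : l \in factor_generators b -> on b l.
Proof.
rewrite mem_cat => /orP[/mapP[i _ ->]|].
  by have := c_on b; rewrite -{1}(cat_take_drop i (c b)) on_cat => /andP[].
case: asboolP => //_; rewrite inE => /eqP ->; rewrite -[c b]pw1 -pwN.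
exact: on_pw.
Qed.

Lemma subset_cat (s t L : seq (word Z)) : {subset s <= L} -> {subset t <= L} -> {subset s ++ t <= L}.
Proof. by move=> sL tL l; rewrite mem_cat => /orP[/sL|/tL]. Qed.

Lemma factor_monoid_on b m : factor_monoid b m -> on b m. Proof. by case. Qed.

Lemma factor_monoid_feq b m m' : factor_monoid b m -> on b m' -> feq m m' -> factor_monoid b m'.
Proof. by move=> [mb [s sL sm]] mb' mm'; split=> //; exists s; rewrite // sm. Qed.

Lemma factor_monoid_cat b m m' : factor_monoid b m -> factor_monoid b m' -> factor_monoid b (m ++ m').
Proof.
move=> [mb [s sL sm]] [mb' [s' sL' sm']]; split; first by rewrite on_cat mb.
by exists (s ++ s'); [apply: subset_cat | rewrite flatten_cat sm sm'].
Qed.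

Lemma factor_monoid_nil b : factor_monoid b [::].
Proof. by split=> //; exists [::]. Qed.

Lemma factor_monoid_gen b l : l \in factor_generators b -> factor_monoid b l.
Proof.
move=> lL; split; first exact: on_factor_generators.
by exists [:: l]; [move=> l'; rewrite inE => /eqP -> | rewrite /= cats0].
Qed.

Lemma factor_monoid_take b i : factor_monoid b (take i (c b)).
Proof. by apply: factor_monoid_gen; rewrite mem_cat mem_prefixes. Qed.

Lemma factor_monoid_c b : factor_monoid b (c b).
Proof. by rewrite -[c b]take_size; apply: factor_monoid_take. Qed.

Lemma winv_npow n (x : word Z) : winv (npow x n) = npow (winv x) n.
Proof. by elim: n => // n IHn; rewrite npowSr winv_cat IHn. Qed.

Lemma factor_monoid_npow b m n : factor_monoid b m -> factor_monoid b (npow m n).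
Proof.
by move=> Mm; elim: n => [|n IHn]; [apply: factor_monoid_nil | apply: factor_monoid_cat].
Qed.

(** If no side generates the inverse of [c], no negative power occurs: multiplying [c^-(n+1)] by
    [c^n] would express [c^-1] by prefixes. *)
Lemma factor_monoid_pw b b' k : factor_monoid b (pw (c b) k) -> factor_monoid b' (pw (c b') k).
Proof.
case: k => n; first by move=> _; apply/factor_monoid_npow/factor_monoid_c.
case: (pselect inverse_generated) => [ig _|nig Mn].
  rewrite /pw winv_npow; apply/factor_monoid_npow/factor_monoid_gen.
  by rewrite mem_cat asboolT // mem_head orbT.
have [_ [s sL sE]] := factor_monoid_cat Mn (factor_monoid_npow n (factor_monoid_c b)).
have sP : {subset s <= prefixes b}.
  by move=> l /sL; rewrite mem_cat (asboolF nig) orbF.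
case: nig; exists b, s => //; rewrite sE /pw npowSr winv_cat -catA gp_Vcat cats0 //.
Qed.

Lemma prefix_monoidE x : prefix_monoid w x <-> generated c factor_monoid x.
Proof.
have w1 : geq w [::] := cg_rel (gp_relator w).
(* A prefix of the relator that goes beyond [c false] equals a prefix of [c true], because [c false]
   equals [c true] in the group. *)
have take_geq i : geq (c false ++ winv (drop i (c true))) (take i (c true)).
  apply: (gp_Icat (p := winv (take i (c true)))).
  by rewrite -catA -winv_cat cat_take_drop gp_catV.
split=> [|[s sM xs]].
  elim=> {x} [x|||].
  - rewrite prefixE => /eqP <-; rewrite take_cat; case: ltnP => _.
      exact: M_generated (factor_monoid_take false _).
    rewrite /winv take_rev -map_drop -/(winv _).
    by apply: generated_geq (take_geq _) _; apply: M_generated (factor_monoid_take true _).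
  - by exists [::].
  - by move=> p q _ Pp _ Pq; apply: generated_cat.
  - by move=> p q pq _; apply: generated_geq; symmetry.
have P_take b i : prefix_monoid w (take i (c b)).
  case: b; last by apply: pm_prefix; apply: (prefix_trans (prefix_take _ _)); apply: prefix_prefix.
  apply: pm_eq (take_geq i) _; apply: pm_prefix; apply/prefixP; exists (winv (take i (c true))).
  by rewrite -catA -winv_cat cat_take_drop.
have P_flatten (t : seq (word Z)) : (forall l, l \in t -> prefix_monoid w l) -> prefix_monoid w (flatten t).
  elim: t => [|l t IHt] tP; first exact: pm_one.
  apply: pm_mul; first by apply: tP; rewrite mem_head.
  by apply: IHt => l' l't; apply: tP; rewrite inE l't orbT.
apply: pm_eq (cg_sym xs) _; apply: (P_flatten _) => m /sM[b [_ [t tL tm]]].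
apply: pm_eq (free_gp_eq w tm) _; apply: (P_flatten _) => l /tL.
rewrite mem_cat => /orP[/mapP[i _ ->]|]; first exact: P_take.
(* The adjoined inverse of [c b] is already in the prefix monoid: it equals the inverse of [c b'], a
   product of prefixes of [c b']. *)
case: asboolP => // -[b' [t' t'L t'E]]; rewrite inE => /eqP ->.
apply: pm_eq (_ : geq (flatten t') _) _.
  rewrite (free_gp_eq w t'E); apply: gp_eq_winv.
  by have := geq_pw c b' b 1; rewrite !pw1.
by apply: (P_flatten _) => l' /t'L /mapP[i _ ->].
Qed.

(** * Regularity of the conditions on syllables *)

Definition powers b : seq (word Z) := [:: c b; winv (c b)].

Lemma flatten_powers b s : {subset s <= powers b} -> in_amalgam b (flatten s).
Proof.
elim: s => [|l s IHs] sL; first by exists 0%R.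
have [k kE] : in_amalgam b (flatten s) by apply: IHs => l' l's; apply: sL; rewrite inE l's orbT.
have: l \in powers b by apply: sL; rewrite mem_head.
rewrite !inE => /orP[] /eqP ->; [exists (1 + k)%R | exists (- 1 + k)%R]; rewrite pwD ?pwN pw1 /= kE //.
Qed.

Lemma powers_flatten b k : exists2 s, {subset s <= powers b} & flatten s = pw (c b) k.
Proof.
have nE x n : x \in powers b -> exists2 s, {subset s <= powers b} & flatten s = npow x n.
  move=> xL; exists (nseq n x); first by move=> l /nseqP[->].
  by elim: n => //= n ->.
by case: k => n; rewrite /pw ?winv_npow; apply: nE; rewrite !inE eqxx ?orbT.
Qed.

Lemma in_amalgamE b g : in_amalgam b g <-> exists2 t, monoid_product [:: powers b] t & feq t g.
Proof.
split=> [[k gk]|[t /monoid_product_cons[s [x [sL /monoid_product_nil -> ->]]]]].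
  have [s sL sE] := powers_flatten b k; exists (flatten s); last by rewrite sE gk.
  by apply/monoid_product_cons; exists s, [::]; rewrite cats0; split=> //; apply/monoid_product_nil.
by rewrite cats0 => sg; have [k kE] := flatten_powers sL; exists k; rewrite -sg.
Qed.

(** Moving the powers of [c] across the equation turns the condition into non-membership in a
    product of finitely generated submonoids, within the scope of Benois's theorem. *)
Lemma avoidsE l r b g : on b g -> avoids c factor_monoid l r b g <->
  ~ exists2 t, monoid_product [:: if l then powers b else [::]; factor_generators b;
                                  if r then powers b else [::]] t & feq t g.
Proof.
move=> gb; split=> [av [t]|nt i j li rj [_ [s sL sE]]].
  move=> /monoid_product_cons[s1 [x1 [s1L /monoid_product_cons[s2 [x2 [s2L + ->]]] ->]]].
  move=> /monoid_product_cons[s3 [x3 [s3L /monoid_product_nil -> ->]]]; rewrite cats0 => tg.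
  have end_pw (e : bool) s : {subset s <= if e then powers b else [::]} ->
      exists2 k : int, e || (k == 0%R) & feq (flatten s) (pw (c b) k).
    case: e => [/flatten_powers[k kE]|]; first by exists k.
    by case: s => [|x s] sL; [exists 0%R | have := sL x; rewrite mem_head => /(_ isT)].
  have [i li iE] := end_pw _ _ s1L; have [j rj jE] := end_pw _ _ s3L.
  apply: (av (- i)%R (- j)%R); [by case: (l) li => //= /eqP ->| by case: (r) rj => //= /eqP -> |].
  split; first by rewrite !on_cat gb !on_pw.
  exists s2 => //; rewrite !pwN -tg iE jE -!catA gp_catVK gp_catV cats0 //.
have end_pw (e : bool) (k : int) : e || (k == 0%R) ->
    exists2 s, {subset s <= if e then powers b else [::]} & flatten s = pw (c b) (- k)%R.
  case: e => [_|/= /eqP ->]; last by exists [::].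
  by have [s' s'L s'E] := powers_flatten b (- k)%R; exists s'.
have [s1 s1L s1E] := end_pw _ _ li; have [s3 s3L s3E] := end_pw _ _ rj.
apply: nt; exists (flatten s1 ++ flatten s ++ flatten s3).
  apply/monoid_product_cons; exists s1, (flatten s ++ flatten s3); split=> //.
  apply/monoid_product_cons; exists s, (flatten s3); split=> //.
  apply/monoid_product_cons; exists s3, [::]; rewrite cats0; split=> //.
  exact/monoid_product_nil.
by rewrite s1E s3E sE !pwN -!catA gp_catV cats0 gp_catVK.
Qed.

Lemma regular_reduced_avoid LL : regular (fun g : word Z =>
  reduced g /\ ~ exists2 t, monoid_product LL t & feq t g).
Proof.
have [L rL LP] := regular_monoid_product LL.
apply: regular_ext (regular_and (regular_sorted (fun a b => b != linv a)) (regular_not rL)) _ => g.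
by split=> -[rg nL]; split=> // /(LP _ rg).
Qed.

Lemma regular_syllable b : regular (syllable side c b).
Proof.
apply: regular_ext (regular_and (regular_all (fun a : Z * bool => side a.1 == b))
  (regular_reduced_avoid [:: powers b])) _ => g.
by split=> [[gb [rg nA]]|[gb rg nA]]; [split=> // /in_amalgamE | split=> //; split=> // /in_amalgamE].
Qed.

Lemma regular_avoids l r b :
  regular (fun g => [/\ on b g, reduced g & avoids c factor_monoid l r b g]).
Proof.
apply: regular_ext (regular_and (regular_all (fun a : Z * bool => side a.1 == b))
  (regular_reduced_avoid [:: if l then powers b else [::]; factor_generators b;
                             if r then powers b else [::]])) _ => g.
split=> [[gb [rg nA]]|[gb rg nA]]; first by split=> //; apply/avoidsE.
by split=> //; split=> //; apply/avoidsE.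
Qed.

(** * Enumeration of certificates and of the complements *)

Local Notation certificate := (certificate side c factor_monoid).

Let base_ok (o : option bool) b g :=
  syllable side c b g /\ if o is Some r then avoids c factor_monoid false r b g else True.

(** The conditions on the new syllable in the rules of [certificate] that extend a product, [o]
    being the kind of the old certificate and [o'] that of the new one. *)
Let step_ok (o o' : option bool) b g := syllable side c b g /\
  match o, o' with
  | None, None => True
  | None, Some r => avoids c factor_monoid true r b g
  | Some false, Some r => avoids c factor_monoid false r b g
  | Some true, Some _ => True
  | Some _, None => False
  end.

Let connector (o : option bool) b : word Z := if o is Some false then c (~~ b) else [::].

Let RE_syllable_and (P : word Z -> Prop) b :
  (P = fun _ => True) \/ (P = fun _ => False) \/ (exists l r, P = avoids c factor_monoid l r b) ->
  RE (fun g => syllable side c b g /\ P g).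
Proof.
have rs := regular_syllable b.
case=> [->|[->|[l [r ->]]]]; first by apply: RE_ext (RE_regular rs) _ => g; tauto.
  by apply: RE_ext (RE_regular (regular_and rs (regular_not rs))) _ => g; tauto.
apply: RE_ext (RE_regular (regular_and rs (regular_avoids l r b))) _ => g.
by split=> [[sg []]|[[gb rg nA] av]].
Qed.

Lemma RE_certificate o b : RE (certificate o b).
Proof.
pose T := (option bool * bool)%type.
pose step (z z' : T * word Z) := exists2 i, i \in enum {: option bool * option bool * bool} &
  exists h g, z = ((i.1.1, ~~ i.2), h) /\ z' = ((i.1.2, i.2), h ++ connector i.1.1 i.2 ++ g) /\
    step_ok i.1.1 i.1.2 i.2 g.
have RE_base o' b' : RE (base_ok o' b').
  by apply: RE_syllable_and; case: o' => [r|]; [right; right; exists false, r | left].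
have re_step : RE (fun z => step z.1 z.2).
  apply: RE_has => -[[o1 o2] b']; do 2 apply: RE_ex.
  apply: RE_and; first by apply: RE_eq; computable_solve.
  apply: RE_and; first by apply: RE_eq; computable_solve.
  apply: (RE_preim (P := step_ok o1 o2 b')); last by computable_solve.
  apply: RE_syllable_and; case: o1 o2 => [[]|] [r|]; [by left | by right; left | | by right; left | | by left].
    by right; right; exists false, r.
  by right; right; exists true, r.
apply: (RE_ext (P := fun x => exists2 i, i \in enum {: option bool * bool} &
    exists g, base_ok i.1 i.2 g /\ clos_refl_trans_1n _ step (i, g) ((o, b), x))).
  apply: RE_has => -[o' b']; apply: RE_ex; apply: RE_and.
    by apply: (RE_preim (RE_base o' b')); computable_solve.
  by apply: RE_rel (RE_star re_step) _ _; computable_solve.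
move=> x; split=> [[[o' b'] _ [g [[sg gok] st]]]|].
  have sound z z' : clos_refl_trans_1n _ step z z' ->
      certificate z.1.1 z.1.2 z.2 -> certificate z'.1.1 z'.1.2 z'.2.
    elim=> // {z z'} z z1 z2 [[[o1 o2] b1] _ [h [g1 [-> [-> [sg1 ok1]]]]]] _ IH /= hc; apply: IH.
    case: o1 o2 sg1 ok1 hc => [[]|] [r|] //= sg1 ok1 hc.
    - exact: certificate_all.
    - exact: certificate_step.
    - exact: certificate_left.
    - exact: certificate_cat.
  apply: (sound _ _ st) => /=; case: o' sg gok {st} => [r|] sg gok; first exact: certificate_avoid.
  exact: certificate_base.
move=> cx; suff [i [g [gok st]]] : exists i g, base_ok i.1 i.2 g /\
    clos_refl_trans _ step (i, g) ((o, b), x).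
  by exists i; rewrite ?mem_enum //; exists g; split=> //; apply: clos_rt_rt1n.
have ext o1 o2 b1 h g1 : step_ok o1 o2 b1 g1 ->
    (exists i g, base_ok i.1 i.2 g /\ clos_refl_trans _ step (i, g) ((o1, ~~ b1), h)) ->
    exists i g, base_ok i.1 i.2 g /\
      clos_refl_trans _ step (i, g) ((o2, b1), h ++ connector o1 b1 ++ g1).
  move=> ok1 [i [g [gok st]]]; exists i, g; split=> //; apply: rt_trans st _; apply: rt_step.
  by exists (o1, o2, b1); rewrite ?mem_enum //; exists h, g1.
elim: cx => {o b x} [b g sg|r b g sg av|b h g _ IH sg|r b h g _ IH sg av|r b h g _ IH sg av|r b h g _ IH sg].
- by exists (None, b), g; split=> //; apply: rt_refl.
- by exists (Some r, b), g; split=> //; apply: rt_refl.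
- exact: (ext None None).
- exact: (ext None (Some r)).
- exact: (ext (Some false) (Some r)).
- exact: (ext (Some true) (Some r)).
Qed.

Lemma RE_not_gp_eq_nil : RE (fun x => ~ geq x [::]).
Proof.
apply: (RE_ext (P := fun x : word Z =>
  (exists y : word Z, geq x y /\ exists2 b, b \in enum {: bool} & certificate None b y) \/
  (exists g : word Z, geq x g /\ exists2 b, b \in enum {: bool} & [/\ on b g, reduced g & g <> [::]]))).
  apply: RE_or; apply: RE_ex; apply: RE_and.
  1,3: by apply: RE_rel (RE_gp_eq w) _ _; computable_solve.
    by apply: RE_has => b; apply: (RE_preim (RE_certificate None b)); computable_solve.
  apply: RE_has => b.
  have rnil : regular (fun g : seq (Z * bool) => g = [::]).
    exists bool, (fun _ _ => false), true, id => -[|a s] //=.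
    by rewrite (_ : foldl _ false s = false) //; elim: s.
  have rg := regular_and (regular_and (regular_all (fun a : Z * bool => side a.1 == b))
    (regular_sorted (fun a b : Z * bool => b != linv a))) (regular_not rnil).
  apply: (RE_preim (P := fun g : word Z => [/\ on b g, reduced g & g <> [::]])).
    by apply: RE_ext (RE_regular rg) _ => g; split=> [[[]]|[]].
  by computable_solve.
move=> x; rewrite (not_geq_nilP c_reduced c_neq0 c_on factor_monoid_on factor_monoid_feq
  factor_monoid_cat factor_monoid_nil factor_monoid_c factor_monoid_pw).
split.
  by case=> [[y [xy [b _ yb]]]|[g [xg [b _ gb]]]]; [left; exists y | right; exists g] => //; exists b.
by case=> [[y xy [b yb]]|[g xg [b gb]]]; [left; exists y | right; exists g]; split=> //;
  exists b; rewrite ?mem_enum.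
Qed.

Lemma RE_not_prefix_monoid : RE (fun x => ~ prefix_monoid w x).
Proof.
apply: (RE_ext (P := fun x : word Z =>
  (exists y : word Z, geq x y /\ exists2 b, b \in enum {: bool} & certificate (Some false) b y) \/
  (exists g : word Z, geq x g /\ exists2 b, b \in enum {: bool} &
     [/\ on b g, reduced g & avoids c factor_monoid false false b g]))).
  apply: RE_or; apply: RE_ex; apply: RE_and.
  1,3: by apply: RE_rel (RE_gp_eq w) _ _; computable_solve.
    by apply: RE_has => b; apply: (RE_preim (RE_certificate (Some false) b)); computable_solve.
  by apply: RE_has => b; apply: (RE_preim (RE_regular (regular_avoids false false b))); computable_solve.
move=> x; rewrite prefix_monoidE (not_generatedP c_reduced c_neq0 c_on factor_monoid_on factor_monoid_feq
  factor_monoid_cat factor_monoid_nil factor_monoid_c factor_monoid_pw).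
split.
  by case=> [[y [xy [b _ yb]]]|[g [xg [b _ gb]]]]; [left; exists y | right; exists g] => //; exists b.
by case=> [[y xy [b yb]]|[g xg [b gb]]]; [left; exists y | right; exists g]; split=> //;
  exists b; rewrite ?mem_enum.
Qed.

Lemma RE_not_inv_eq : RE (fun z => ~ inv_eq w z.1 z.2).
Proof.
have reC := RE_not_covers RE_not_prefix_monoid.
(* The three ways of failing [inv_eqP]; an uncovered prefix is found by guessing a factorization. *)
apply: (RE_ext (P := fun z => (exists q', q' = winv z.2 /\ ~ geq (z.1 ++ q') [::]) \/
  (exists x y, z.1 = x ++ y /\ ~ covers w z.2 x) \/ (exists x y, z.2 = x ++ y /\ ~ covers w z.1 x))).
  apply: RE_or; last apply: RE_or.
  - apply: RE_ex; apply: RE_and.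
      by apply: (RE_rel (R := fun p q => q = winv p) (@RE_winv Z)); computable_solve.
    by apply: (RE_preim RE_not_gp_eq_nil); computable_solve.
  - do 2 apply: RE_ex; apply: RE_and; first by apply: RE_eq; computable_solve.
    by apply: (RE_rel (R := fun p q => ~ covers w p q) reC); computable_solve.
  - do 2 apply: RE_ex; apply: RE_and; first by apply: RE_eq; computable_solve.
    by apply: (RE_rel (R := fun p q => ~ covers w p q) reC); computable_solve.
case=> p q /=; rewrite (inv_eqP c_reduced c_neq0 c_on); split.
  case=> [[q' [-> nE]]|[[x [y [-> nC]]]|[x [y [-> nC]]]]] [pq cov_q cov_p].
  - by apply: nE; rewrite pq gp_catV.
  - by apply: nC; have := cov_q (size x); rewrite take_size_cat.
  - by apply: nC; have := cov_p (size x); rewrite take_size_cat.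
move=> nE; case: (pselect (geq p q)) => [pq|npq]; last first.
  left; exists (winv q); split=> // E; apply: npq.
  by apply: (gp_Icat (p := winv q)); rewrite E gp_catV.
right; case: (pselect (forall i, covers w q (take i p))) => [cov_q|/existsNP[i nC]]; last first.
  by left; exists (take i p), (drop i p); rewrite cat_take_drop.
right; case: (pselect (forall i, covers w p (take i q))) => [cov_p|/existsNP[i nC]].
  by exfalso; apply: nE; split.
by exists (take i q), (drop i q); rewrite cat_take_drop.
Qed.
End PrefixMonoid.

Theorem theorem5p10 (X Y : finType) (u : word X) (v : word Y) :
  u <> [::] -> v <> [::] -> reduced u -> reduced v ->
  prefix_membership_decidable (pinched u v) /\
  inv_word_problem_decidable (pinched u v).
Proof.
move=> u0 v0 ru rv.
pose side (z : X + Y) := if z is inr _ then true else false.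
pose c (b : bool) : word (X + Y) := if b then wmap inr v else wmap inl u.
have c_reduced b : reduced (c b).
  have red (Z : finType) (f : Z -> X + Y) p : injective f -> reduced p -> reduced (wmap f p).
    move=> f_inj; rewrite /reduced /wmap sorted_map; apply: sub_sorted => x y /=.
    by apply: contraNN => /eqP[/f_inj E1 E2]; apply/eqP; case: x y E1 E2 => [x1 x2] [y1 y2] /= -> ->.
  by rewrite /c; case: b; apply: red => // x y [].
have c_neq0 b : c b <> [::] by rewrite /c; case: b; [case: (v) v0 | case: (u) u0].
have c_on b : on side b (c b).
  by case: b; rewrite /on /c /wmap all_map; apply/allP => a _; apply/eqP.
split.
  apply: (RE_decidable_set (A := (X + Y) * bool)%type); first exact: RE_prefix_monoid.
  exact: RE_not_prefix_monoid c_reduced c_neq0 c_on.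
apply: (RE_decidable_rel (A := (X + Y) * bool)%type); first exact: RE_inv_eq.
exact: RE_not_inv_eq c_reduced c_neq0 c_on.
Qed.
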